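(* Let $f=\frac1n\sum_{i=1}^nf_i$ with each $f_i$ continuously differentiable, $f\ge f^\star$ for some $f^\star\in\mathbb{R}$, each $f_i$ with ${\bm L}_i$-Lipschitz gradient and $f$ with ${\bm L}$-Lipschitz gradient (${\bm L}_i,{\bm L}\in\mathbb{S}^d_{++}$). Let $p\in(0,1]$ and ${\bm D}\in\mathbb{S}^d_{++}$ satisfy $${\bm D}^{-1}\succeq\left(\frac{(1-p)R'({\bm D},\mathcal S)}{np}+1\right){\bm L},$$ where $R'({\bm D},\mathcal S)=\frac1n\sum_{i=1}^n\lambda_{\max}\!\left({\bm D}\,\mathbb{E}[{\bm T}{\bm D}^{-1}{\bm T}]\,{\bm D}-{\bm D}\right)\lambda_{\max}({\bm L}_i)\lambda_{\max}({\bm L}^{-1/2}{\bm L}_i{\bm L}^{-1/2})$ with ${\bm T}\sim\mathcal S$. Then after $K\ge1$ iterations of det-CGD2-VR, $$\mathbb{E}\left[\|\nabla f(\tilde x^K)\|^2_{{\bm D}/\det({\bm D})^{1/d}}\right]\le\frac{2(f(x^0)-f^\star)}{\det({\bm D})^{1/d}K}.$$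
   Context: Notation: $\mathbb{S}^d_{++}$ symmetric positive definite matrices; $\|x\|_{\bm M}^2:=x^\top{\bm M}x$; $\lambda_{\max}$ largest eigenvalue; a differentiable $g$ has ${\bm L}$-Lipschitz gradient if $\|\nabla g(x)-\nabla g(y)\|_{{\bm L}^{-1}}\le\|x-y\|_{\bm L}$ for all $x,y$. Sketches ${\bm T}_i^k$ are i.i.d. from a distribution $\mathcal S$ on symmetric positive semidefinite matrices with $\mathbb{E}[{\bm T}]={\bm I}_d$ and finite second moments, independent of everything else. Algorithm det-CGD2-VR (input $x^0,{\bm D},p,K$): $g^0={\bm D}\nabla f(x^0)$; for $k=0,\dots,K-1$: sample $c_k\sim\mathrm{Bernoulli}(p)$; $x^{k+1}=x^k-g^k$; for each $i$: $g_i^{k+1}={\bm D}\nabla f_i(x^{k+1})$ if $c_k=1$, else $g_i^{k+1}=g^k+{\bm T}_i^k{\bm D}(\nabla f_i(x^{k+1})-\nabla f_i(x^k))$; $g^{k+1}=\frac1n\sum_ig_i^{k+1}$. Output $\tilde x^K$ uniform from $\{x^0,\dots,x^{K-1}\}$. Expectation over all randomness. *)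

(* Defs.v *)
From HB Require Import structures.
From mathcomp Require Import all_boot all_order all_algebra.
From mathcomp Require Import all_classical all_reals all_analysis.
Set Implicit Arguments. Unset Strict Implicit. Unset Printing Implicit Defensive.
Import Order.TTheory GRing.Theory Num.Theory.
Import numFieldNormedType.Exports.
Local Open Scope classical_set_scope.
Local Open Scope ring_scope.

Section Defs.
Variable R : realType.
Variable d : nat.

Definition qf (M : 'M[R]_d) (x : 'cV[R]_d) : R := (x^T *m M *m x) ord0 ord0.
Definition mnorm (M : 'M[R]_d) (x : 'cV[R]_d) : R := Num.sqrt (qf M x).

Definition symmetricmx (A : 'M[R]_d) : Prop := A^T = A.
Definition psd (A : 'M[R]_d) : Prop := symmetricmx A /\ forall v, 0 <= qf A v.
Definition spd (A : 'M[R]_d) : Prop := symmetricmx A /\ forall v, v != 0 -> 0 < qf A v.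
Definition loewner_ge (A B : 'M[R]_d) : Prop := psd (A - B).

Definition lambda_max (A : 'M[R]_d) : R := sup [set a : R | eigenvalue A a].

Definition msqrt (A : 'M[R]_d) : 'M[R]_d :=
  xget 0 [set S : 'M[R]_d | spd S /\ S *m S = A].

Definition grad (g : 'cV[R]_d -> R) (x : 'cV[R]_d) : 'cV[R]_d :=
  \col_(j < d) 'D_(delta_mx j ord0) g x.

Definition C1 (g : 'cV[R]_d -> R) : Prop :=
  (forall x, differentiable g x) /\ continuous (grad g).

Definition lipschitz_grad (L : 'M[R]_d) (g : 'cV[R]_d -> R) : Prop :=
  forall x y, mnorm (invmx L) (grad g x - grad g y) <= mnorm L (x - y).

(* Trajectory of det-CGD2-VR for fixed realizations of the coins [c k] and of the
   sketches [T k i] (= T_i^k); returns (x^k, g^k). *)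
Fixpoint detCGD2VR (n : nat) (fi : 'I_n -> 'cV[R]_d -> R) (D : 'M[R]_d)
    (x0 : 'cV[R]_d) (c : nat -> bool) (T : nat -> 'I_n -> 'M[R]_d) (k : nat)
    : 'cV[R]_d * 'cV[R]_d :=
  match k with
  | 0 => (x0, D *m grad (fun x => n%:R^-1 * \sum_(i < n) fi i x) x0)
  | k'.+1 =>
      let: (x, g) := detCGD2VR fi D x0 c T k' in
      let x' := x - g in
      let gi := fun i : 'I_n =>
        if c k' then D *m grad (fi i) x'
        else g + T k' i *m D *m (grad (fi i) x' - grad (fi i) x) in
      (x', n%:R^-1 *: \sum_(i < n) gi i)
  end.

End Defs.

Definition mexpect (R : realType) (d : nat) (dX : measure_display) (X : measurableType dX)
    (S : probability X R) (F : X -> 'M[R]_d) : 'M[R]_d :=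
  \matrix_(i, j) Rintegral S setT (fun x => F x i j).

Definition mutually_independent (R : realType) (dO : measure_display)
    (O : measurableType dO) (P : probability O R) (I : eqType)
    (E : I -> set (set O)) : Prop :=
  forall (J : seq I) (A : I -> set O), uniq J ->
    (forall j, j \in J -> E j (A j)) ->
    P (\bigcap_(j in [set` J]) A j) = (\prod_(j <- J) P (A j))%E.

Definition preimage_sigma (dO dY : measure_display) (O : measurableType dO)
    (Y : measurableType dY) (X : O -> Y) : set (set O) :=
  [set X @^-1` B | B in [set B : set Y | measurable B]].

(* Main.v *)
(** Write e^k = g^k - D grad f(x^k).  Polarizing the L-smoothness inequality in
    the D^-1-norm gives, along every trajectory,
      f(x^{k+1}) <= f(x^k) - 1/2 |grad f(x^k)|_D^2 + 1/2 |e^k|_{D^-1}^2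
                    + 1/2 (|g^k|_L^2 - |g^k|_{D^-1}^2).
    These inequalities are summed pathwise before taking expectations, so that
    only f >= f* is used and no integrability of f(x^k) is required.  The error
    obeys e^{k+1} = (1 - c_k) (e^k + 1/n sum_i (T_i^k - I) u_i) where
    u_i = D (grad f_i(x^{k+1}) - grad f_i(x^k)) depends on the past only.
    Adding the sketches one at a time, independence and E T = I kill every cross
    term, and E (T - I) D^-1 (T - I) = E T D^-1 T - D^-1 together with the
    smoothness of the f_i yields
      E |e^{k+1}|^2 <= (1 - p) (E |e^k|^2 + R'/n E |g^k|_L^2).
    As e^0 = 0, summing this recursion bounds sum_k E |e^k|^2 by
    (1-p)R'/(np) sum_k E |g^k|_L^2, which the step-size condition absorbs. *)
Require Import Defs.
From HB Require Import structures.
From mathcomp Require Import all_boot all_order all_algebra.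
From mathcomp Require Import all_classical all_reals all_analysis measurable_realfun.
From mathcomp Require Import ring lra.
Import Order.TTheory GRing.Theory Num.Theory.
Import numFieldNormedType.Exports.
Set Implicit Arguments. Unset Strict Implicit. Unset Printing Implicit Defensive.
Local Open Scope classical_set_scope.
Local Open Scope ring_scope.

(** * Quadratic forms and largest eigenvalues *)

Section QuadraticForms.
Context {R : realType} {d : nat}.
Implicit Types (M A B : 'M[R]_d) (u v x y z : 'cV[R]_d).

(** No conditional expectation is used. Independence of the fresh randomness from the past is a
    product formula for sigma-algebras generated by finite lists of indices, and expectations of
    products are split by Fubini. The price is that every iterate must be shown measurable for its
    past and square-integrable. This is possible because Lipschitz gradients grow at most linearly
    and because independence keeps products square-integrable, so second moments of the sketches
    suffice.

    Two matrix notions need work because of how they are given: [lambda_max] is a supremum of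
    eigenvalues, so it must be shown to dominate the Rayleigh quotient, and [msqrt] is a choice, so
    a square root has to be constructed. Both rest on Cauchy-Schwarz for semidefinite forms instead
    of a spectral theorem. *)

Definition bf M x y : R := (x^T *m M *m y) ord0 ord0.

Lemma qf_bf M x : qf M x = bf M x x. Proof. by []. Qed.

Lemma bfE M x y : bf M x y = \sum_i \sum_j x i ord0 * M i j * y j ord0.
Proof.
rewrite /bf mxE exchange_big; apply: eq_bigr => j _ /=; rewrite mxE mulr_suml.
by apply: eq_bigr => i _; rewrite mxE.
Qed.

Lemma qf1E x : qf 1%:M x = \sum_i x i ord0 ^+ 2.
Proof.
by rewrite /qf mulmx1 mxE; apply: eq_bigr => i _; rewrite mxE expr2.
Qed.

Lemma bfDl M x y z : bf M (x + y) z = bf M x z + bf M y z.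
Proof. by rewrite /bf linearD /= !mulmxDl mxE. Qed.

Lemma bfDr M x y z : bf M z (x + y) = bf M z x + bf M z y.
Proof. by rewrite /bf mulmxDr mxE. Qed.

Lemma bfNr M x y : bf M x (- y) = - bf M x y.
Proof. by rewrite /bf mulmxN mxE. Qed.

Lemma bfZl M a x y : bf M (a *: x) y = a * bf M x y.
Proof. by rewrite /bf linearZ /= -!scalemxAl mxE. Qed.

Lemma bfZr M a x y : bf M x (a *: y) = a * bf M x y.
Proof. by rewrite /bf -scalemxAr mxE. Qed.

Lemma bfC M x y : Defs.symmetricmx M -> bf M x y = bf M y x.
Proof.
move=> sM; have e : y^T *m M *m x = (x^T *m M *m y)^T.
  by rewrite !trmx_mul trmxK sM mulmxA.
by rewrite /bf e [RHS]mxE.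
Qed.

Lemma qfD M x y : Defs.symmetricmx M ->
  qf M (x + y) = qf M x + 2 * bf M x y + qf M y.
Proof.
by move=> sM; rewrite !qf_bf bfDl !bfDr (bfC y x sM); ring.
Qed.

Lemma qfN M x : qf M (- x) = qf M x.
Proof. by rewrite -scaleN1r !qf_bf bfZl bfZr !mulN1r opprK. Qed.

Lemma qfZ M a x : qf M (a *: x) = a ^+ 2 * qf M x.
Proof. by rewrite !qf_bf bfZl bfZr; ring. Qed.

Lemma qf0 M : qf M 0 = 0.
Proof. by rewrite /qf mulmx0 mxE. Qed.

Lemma qfDm A B x : qf (A + B) x = qf A x + qf B x.
Proof. by rewrite /qf mulmxDr mulmxDl mxE. Qed.

Lemma qfBm A B x : qf (A - B) x = qf A x - qf B x.
Proof. by rewrite /qf mulmxBr mulmxBl !mxE. Qed.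

Lemma qfZm a A x : qf (a *: A) x = a * qf A x.
Proof. by rewrite /qf -scalemxAr -scalemxAl mxE. Qed.

Lemma qf_conj A M x : qf M (A *m x) = qf (A^T *m M *m A) x.
Proof. by rewrite /qf trmx_mul !mulmxA. Qed.

Lemma qf1_ge0 x : 0 <= qf 1%:M x.
Proof. by rewrite qf1E; apply: sumr_ge0 => i _; exact: sqr_ge0. Qed.

Lemma qf1_gt0 x : x != 0 -> 0 < qf 1%:M x.
Proof.
move=> x0; rewrite lt_def qf1_ge0 andbT; apply: contra x0.
rewrite qf1E psumr_eq0 => [/allP h|i _]; last exact: sqr_ge0.
apply/eqP/colP => i; rewrite mxE; apply/eqP.
by rewrite -sqrf_eq0; apply: h; rewrite mem_index_enum.
Qed.

Lemma psd_ge0 M x : psd M -> 0 <= qf M x. Proof. by case. Qed.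

Lemma spd_psd M : spd M -> psd M.
Proof.
case=> sM pM; split=> // v; have [->|/pM/ltW//] := eqVneq v 0.
by rewrite qf0.
Qed.

Lemma psd_cauchy_schwarz M x y : psd M ->
  bf M x y ^+ 2 <= qf M x * qf M y.
Proof.
case=> sM pM.
have h t : 0 <= qf M x * t ^+ 2 + 2 * bf M x y * t + qf M y.
  have := pM (t *: x + y); rewrite qfD // qfZ bfZl; lra.
have [q0|q0] := eqVneq (qf M x) 0.
  rewrite q0 mul0r.
  have [->|b0] := eqVneq (bf M x y) 0; first by rewrite expr0n.
  (* The leading coefficient vanishes, so the polynomial is affine in [t]; this [t] gives it the
     value -1. *)
  have := h (- (qf M y + 1) / (2 * bf M x y)); rewrite q0.
  rewrite (_ : _ + _ + _ = -1); last by field.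
  by rewrite ler0N1.
have qx : 0 < qf M x by rewrite lt_def q0 pM.
(* The minimizer of the parabola; the value there is the discriminant up to a positive factor. *)
have := h (- bf M x y / qf M x).
rewrite (_ : _ + _ + _ = (qf M x * qf M y - bf M x y ^+ 2) / qf M x); last by field.
by rewrite pmulr_lge0 ?invr_gt0 // subr_ge0.
Qed.

(** The sum of the absolute entries works, as |x_i x_j| <= |x|^2. The extra 1 keeps the constant
    positive even for a zero matrix, so that it can be inverted. *)
Lemma qf_bound M : {C : R | 0 < C & forall x, qf M x <= C * qf 1%:M x}.
Proof.
exists (1 + \sum_i \sum_j `|M i j|).
  by rewrite ltr_wpDr // sumr_ge0 // => i _; rewrite sumr_ge0.
move=> x; rewrite mulrDl mul1r ler_wpDl ?qf1_ge0 //.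
rewrite qf_bf bfE mulr_suml; apply: ler_sum => i _.
rewrite mulr_suml; apply: ler_sum => j _.
have le k : x k ord0 ^+ 2 <= qf 1%:M x.
  rewrite qf1E (bigD1 k) //= lerDl sumr_ge0 // => l _; exact: sqr_ge0.
apply: (le_trans (ler_norm _)).
rewrite mulrAC [_ * M i j]mulrC normrM; apply: ler_wpM2l => //.
rewrite ler_norml; have := le i; have := le j.
set a := x i ord0; set b := x j ord0; set q := qf _ _ => hb ha.
by apply/andP; split; have := sqr_ge0 (a + b); have := sqr_ge0 (a - b); nra.
Qed.

(** This is M^2 <= M for 0 <= M <= 1: Cauchy-Schwarz in the M-form between x and Mx, whose mixed
    term is |Mx|^2, and then division by |Mx|^2. *)
Lemma qf_psd_bound M x : psd M -> (forall y, qf M y <= qf 1%:M y) ->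
  qf 1%:M (M *m x) <= qf M x.
Proof.
move=> pM lM; have [z|z] := eqVneq (M *m x) 0.
  by rewrite z qf0; exact: psd_ge0.
have h := psd_cauchy_schwarz x (M *m x) pM.
have e : bf M x (M *m x) = qf 1%:M (M *m x).
  by rewrite /bf /qf trmx_mul pM.1 mulmx1.
have p := qf1_gt0 z; rewrite -(ler_pM2r p).
rewrite -expr2 -e; apply: (le_trans h); apply: ler_wpM2l; first exact: psd_ge0.
by rewrite e; exact: lM.
Qed.

Lemma mulmx_unit_inj M : (forall x, M *m x = 0 -> x = 0) -> M \in unitmx.
Proof.
move=> h; rewrite -unitmx_tr unitmxE unitfE; apply/negP => /det0P[v v0 e].
have : M *m v^T = 0 by rewrite -[M]trmxK -trmx_mul e trmx0.
by move/h/(congr1 trmx); rewrite trmxK trmx0 => /eqP; rewrite (negPf v0).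
Qed.

Lemma spd_unitmx M : spd M -> M \in unitmx.
Proof.
case=> sM pM; apply: mulmx_unit_inj => x e; apply/eqP/negPn/negP => /pM.
by rewrite /qf -mulmxA e mulmx0 mxE ltxx.
Qed.

Lemma qf_invmx M x : spd M -> qf (invmx M) x = qf M (invmx M *m x).
Proof.
move=> pM; have uM := spd_unitmx pM.
by rewrite qf_conj trmx_inv pM.1 mulVmx // mul1mx.
Qed.

Lemma spd_invmx M : spd M -> spd (invmx M).
Proof.
move=> pM; have uM := spd_unitmx pM; split.
  by rewrite /Defs.symmetricmx trmx_inv pM.1.
move=> v v0; rewrite qf_invmx //; apply: pM.2.
by apply: contra v0 => /eqP e; rewrite -(mulKVmx uM v) e mulmx0.
Qed.

Lemma spd_scale a M : 0 < a -> spd M -> spd (a *: M).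
Proof.
move=> a0 [sM pM]; split; first by rewrite /Defs.symmetricmx linearZ /= sM.
by move=> v v0; rewrite qfZm mulr_gt0 // pM.
Qed.

Lemma eigenvalue_sym_qf A a : Defs.symmetricmx A -> eigenvalue A a ->
  exists2 v, v != 0 & qf A v = a * qf 1%:M v.
Proof.
move=> sA /eigenvalueP[v e v0]; exists v^T.
  by apply: contra v0 => /eqP/(congr1 trmx); rewrite trmxK trmx0 => ->.
by rewrite /qf trmxK e mulmx1 -scalemxAl mxE.
Qed.

(** The supremum m of the Rayleigh quotient is itself an eigenvalue. Otherwise B = m - A is positive
    semidefinite and invertible, and Cauchy-Schwarz between v and B^-1 v gives 1 <= (m - v^T A v) c
    on unit vectors, with c a bound for B^-1. This fails for v close to the supremum. No maximizer
    has to exist beforehand. *)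
Lemma lambda_max_ub A x : Defs.symmetricmx A ->
  qf A x <= lambda_max A * qf 1%:M x.
Proof.
move=> sA; have [->|x0] := eqVneq x 0; first by rewrite !qf0 mulr0.
pose V := [set qf A v | v in [set v | qf 1%:M v = 1]].
have [C C0 hC] := qf_bound A.
have nrm y : y != 0 -> V (qf A y / qf 1%:M y).
  move=> y0; have qy := qf1_gt0 y0.
  exists ((Num.sqrt (qf 1%:M y))^-1 *: y); rewrite /= qfZ exprVn sqr_sqrtr ?ltW //.
    by rewrite mulVf ?gt_eqF.
  by rewrite mulrC.
have supV : has_sup V.
  split; first by exists (qf A x / qf 1%:M x); exact: nrm.
  by exists C => _ [v /= v1 <-]; have := hC v; rewrite v1 mulr1.
pose m := sup V.
have qm y : qf A y <= m * qf 1%:M y.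
  have [->|y0] := eqVneq y 0; first by rewrite !qf0 mulr0.
  rewrite -ler_pdivrMr ?qf1_gt0 //; apply: ub_le_sup; first by case: supV.
  exact: nrm.
suff em : eigenvalue A m.
  apply: (le_trans (qm x)); apply: ler_wpM2r; first exact: qf1_ge0.
  apply: ub_le_sup => //; exists C => a /(eigenvalue_sym_qf sA)[v v0 qv].
  by rewrite -(ler_pM2r (qf1_gt0 v0)) -qv; exact: hC.
pose B := m%:M - A.
have qB y : qf B y = m * qf 1%:M y - qf A y.
  by rewrite qfBm -(scalemx1 _ m) qfZm.
have pB : psd B.
  split; first by rewrite /Defs.symmetricmx /B linearB /= tr_scalar_mx sA.
  by move=> v; rewrite qB subr_ge0.
have [uB|uB] := boolP (B \in unitmx); last first.
  move: uB; rewrite unitmxE unitfE negbK => /det0P[v v0 e].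
  apply/eigenvalueP; exists v => //; apply/eqP; rewrite eq_sym -subr_eq0.
  by rewrite -mul_mx_scalar -mulmxBr e.
exfalso; have [c c0 hc] := qf_bound (invmx B).
have c1 : 0 < c^-1 by rewrite invr_gt0.
have [_ [v /= v1 <-]] := sup_adherent c1 supV.
rewrite -/m => lt.
have := psd_cauchy_schwarz v (invmx B *m v) pB.
rewrite {1}/bf -(mulmxA (v^T)) mulKVmx // -{1}(mulmx1 v^T) -/(qf 1%:M v) v1 expr1n.
rewrite qf_conj trmx_inv pB.1 mulVmx // mul1mx.
have := hc v; have := pB.2 v; rewrite qB v1 !mulr1 => p1 p2.
move=> h; have : 1 < 1 :> R; last by rewrite ltxx.
apply: (le_lt_trans h); apply: (le_lt_trans (ler_wpM2l p1 p2)).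
by rewrite -ltr_pdivlMr // mul1r; lra.
Qed.

(** Cauchy-Schwarz in the A-form between A^-1 x and x. It turns a bound in a dual norm, as in the
    Lipschitz condition, into a Euclidean one. *)
Lemma lambda_max_inv A x : spd A ->
  qf 1%:M x <= lambda_max A * qf (invmx A) x.
Proof.
move=> pA; have uA := spd_unitmx pA.
have [->|x0] := eqVneq x 0; first by rewrite !qf0 mulr0.
have h := psd_cauchy_schwarz (invmx A *m x) x (spd_psd pA).
have e : bf A (invmx A *m x) x = qf 1%:M x.
  by rewrite /bf /qf trmx_mul trmx_inv pA.1 mulmxKV // mulmx1.
have p := qf1_gt0 x0; rewrite -(ler_pM2r p) -expr2 -{1}e.
apply: (le_trans h); rewrite -qf_invmx // mulrAC [leRHS]mulrC.
apply: ler_wpM2l; first exact: psd_ge0 (spd_psd (spd_invmx pA)).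
by apply: lambda_max_ub; case: pA.
Qed.

Lemma lambda_max_ge0 A : (0 < d)%N -> psd A -> 0 <= lambda_max A.
Proof.
move=> d0 [sA pA]; pose v : 'cV[R]_d := const_mx 1.
have v0 : v != 0.
  apply/eqP => /colP/(_ (Ordinal d0)); rewrite !mxE => /eqP.
  by rewrite oner_eq0.
have := le_trans (pA v) (lambda_max_ub v sA).
by rewrite pmulr_lge0 // qf1_gt0.
Qed.

End QuadraticForms.

(** * Square roots of positive definite matrices *)

Section PsdClosure.
Context {R : realType} {d : nat}.
Implicit Types (A B : 'M[R]_d).

Lemma psd0 : psd (0 : 'M[R]_d).
Proof.
split=> [|v]; first by rewrite /Defs.symmetricmx trmx0.
by rewrite /qf mulmx0 mul0mx mxE.
Qed.

Lemma psdD A B : psd A -> psd B -> psd (A + B).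
Proof.
move=> [sA pA] [sB pB]; split; first by rewrite /Defs.symmetricmx linearD /= sA sB.
by move=> v; rewrite qfDm addr_ge0.
Qed.

Lemma psdZ a A : 0 <= a -> psd A -> psd (a *: A).
Proof.
move=> a0 [sA pA]; split; first by rewrite /Defs.symmetricmx linearZ /= sA.
by move=> v; rewrite qfZm mulr_ge0.
Qed.

Lemma psd_sum I (r : seq I) (F : I -> 'M[R]_d) :
  (forall i, psd (F i)) -> psd (\sum_(i <- r) F i).
Proof.
by move=> pF; elim/big_ind: _ => // [|A B]; [exact: psd0 | exact: psdD].
Qed.

End PsdClosure.

Lemma cvgn_sum {R : realType} I (r : seq I) (F : I -> nat -> R) (l : I -> R) :
  (forall i, F i @ \oo --> l i) ->
  (fun k => \sum_(i <- r) F i k) @ \oo --> \sum_(i <- r) l i.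
Proof. by move=> Fl; apply: cvg_big => //; exact: add_continuous. Qed.

Section SquareRoot.
Context {R : realType} {d : nat}.
Implicit Types (A B S : 'M[R]_d.+1) (p : {poly R}).

Lemma trmx_expr B k : (B ^+ k)^T = (B^T) ^+ k.
Proof.
elim: k => [|k IH]; first by rewrite !expr0 trmx1.
by rewrite exprS exprSr -mulmxE trmx_mul IH.
Qed.

(** Halving the exponent exhibits B^k as a congruence of B or of the identity. *)
Lemma psd_expr B k : psd B -> psd (B ^+ k).
Proof.
move=> pB; have sX j : (B ^+ j)^T = B ^+ j by rewrite trmx_expr pB.1.
split; first exact: sX.
move=> v; have -> : B ^+ k = B ^+ k./2 *m B ^+ odd k *m B ^+ k./2.
  by rewrite !mulmxE -!exprD -addnA addnCA addnn odd_double_half.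
rewrite -{1}(sX k./2) -qf_conj; case: (odd k); first by rewrite expr1; exact: pB.2.
by rewrite expr0; exact: qf1_ge0.
Qed.

Lemma psd_horner B p : psd B -> p \is a polyOver Num.nneg ->
  psd (horner_mx B p).
Proof.
move=> pB /polyOverP pp; rewrite -[p]coefK poly_def raddf_sum /=.
apply: psd_sum => i; rewrite horner_mxZ rmorphXn /= horner_mx_X.
by apply: psdZ; [exact: pp | exact: psd_expr].
Qed.

(* With [A = 1 - B], the equation [(1 - Y)^2 = A] reads [Y = (B + Y^2) / 2];
   these are its fixed-point iterates as polynomials in [B]. *)
Fixpoint sqrt_poly k : {poly R} :=
  if k is k'.+1 then 2^-1 *: ('X + sqrt_poly k' ^+ 2) else 0.

Lemma sqrt_poly_nneg k : sqrt_poly k \is a polyOver Num.nneg.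
Proof.
elim: k => [|k IH] /=; first exact: polyOver0.
by rewrite polyOverZ ?rpredD ?polyOverX ?rpredX // nnegrE invr_ge0.
Qed.

(** The difference of two successive squares factors, so nonnegativity of the coefficients passes
    from one increment to the next. Evaluated at a positive semidefinite B, the iterates therefore
    increase in the Loewner order. Working with polynomials makes the factors commute. *)
Lemma sqrt_poly_incr k :
  sqrt_poly k.+1 - sqrt_poly k \is a polyOver Num.nneg.
Proof.
elim: k => [|k IH]; first by rewrite [sqrt_poly 0]/= subr0; exact: sqrt_poly_nneg.
rewrite (_ : _ - _ = 2^-1 *: ((sqrt_poly k.+1 - sqrt_poly k) *
   (sqrt_poly k.+1 + sqrt_poly k))).
  apply: polyOverZ; first by rewrite nnegrE invr_ge0.
  by apply: rpredM => //; apply: rpredD; exact: sqrt_poly_nneg.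
by rewrite [in LHS]/= -scalerBr -subr_sqr; congr (_ *: _); rewrite /=; ring.
Qed.

Definition sqrt_iter B k := horner_mx B (sqrt_poly k).

Lemma sqrt_iterS B k :
  sqrt_iter B k.+1 = 2^-1 *: (B + sqrt_iter B k *m sqrt_iter B k).
Proof. by rewrite /sqrt_iter /= horner_mxZ rmorphD /= rmorphXn /= horner_mx_X expr2. Qed.

Lemma qf_sqr S v : Defs.symmetricmx S -> qf (S *m S) v = qf 1%:M (S *m v).
Proof. by move=> sS; rewrite qf_conj sS mulmx1. Qed.

(** The next iterate is the mean of B and Y^2, where B <= 1 and Y^2 <= Y <= 1 by induction. *)
Lemma sqrt_iter_le1 B k v : psd B -> (forall v, qf B v <= qf 1%:M v) ->
  qf (sqrt_iter B k) v <= qf 1%:M v.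
Proof.
move=> pB lB; elim: k v => [|k IH] v.
  by rewrite /sqrt_iter /= rmorph0 /qf mulmx0 mul0mx mxE; exact: qf1_ge0.
have pY : psd (sqrt_iter B k) by apply: psd_horner => //; exact: sqrt_poly_nneg.
rewrite sqrt_iterS qfZm qfDm qf_sqr; last by case: pY.
have := lB v; have := qf_psd_bound v pY IH; have := IH v; lra.
Qed.

(** Polarization on basis vectors, by which monotone convergence of the quadratic forms yields
    convergence of the entries. *)
Lemma mx_entry_qf S i j : Defs.symmetricmx S -> let e k := delta_mx k ord0 in
  S i j = 2^-1 * (qf S (e i + e j) - qf S (e i) - qf S (e j)).
Proof.
move=> sS e; have h k l : bf S (e k) (e l) = S k l.
  rewrite /bf /e trmx_delta -rowE -colE !mxE //.
by rewrite qfD // h; field.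
Qed.

Lemma sqrt_iter_cvg B i j : psd B -> (forall v, qf B v <= qf 1%:M v) ->
  cvgn (fun k => sqrt_iter B k i j).
Proof.
move=> pB lB.
have pY k : psd (sqrt_iter B k) by apply: psd_horner => //; exact: sqrt_poly_nneg.
have cq v : cvgn (fun k => qf (sqrt_iter B k) v).
  apply: nondecreasing_is_cvgn.
    apply/nondecreasing_seqP => k; rewrite -subr_ge0 -qfBm.
    have := psd_horner pB (sqrt_poly_incr k).
    by rewrite rmorphB /= => -[_]; apply.
  by exists (qf 1%:M v) => _ [k _ <-]; exact: sqrt_iter_le1.
rewrite (_ : (fun k => _) = (fun k => 2^-1 * (qf (sqrt_iter B k)
    (delta_mx i ord0 + delta_mx j ord0) - qf (sqrt_iter B k) (delta_mx i ord0)
    - qf (sqrt_iter B k) (delta_mx j ord0)))); last first.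
  by apply/funext => k; apply: mx_entry_qf; case: (pY k).
apply: is_cvgM; first exact: is_cvg_cst.
by apply: is_cvgB; first exact: is_cvgB.
Qed.

(** The iterates for B = 1 - A converge to a fixed point Y = (B + Y^2) / 2 with Y <= 1; hence S = 1
    - Y is positive semidefinite and squares to A. *)
Lemma psd_sqrt_le1 A : spd A -> (forall v, qf A v <= qf 1%:M v) ->
  exists2 S, spd S & S *m S = A.
Proof.
move=> pA lA; pose B := 1%:M - A.
have pB : psd B.
  split; first by rewrite /Defs.symmetricmx linearB /= trmx1 pA.1.
  by move=> v; rewrite qfBm subr_ge0.
have lB v : qf B v <= qf 1%:M v.
  by rewrite qfBm gerBl; exact: (spd_psd pA).2.
have pY k : psd (sqrt_iter B k) by apply: psd_horner => //; exact: sqrt_poly_nneg.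
have [Y cY] : exists Y : 'M[R]_d.+1,
    forall i j, (fun k => sqrt_iter B k i j) @ \oo --> Y i j.
  exists (\matrix_(i, j) limn (fun k => sqrt_iter B k i j)) => i j.
  by rewrite mxE; exact: sqrt_iter_cvg.
have sY : Defs.symmetricmx Y.
  apply/matrixP => i j; rewrite mxE; apply: cvg_unique (cY i j) => //.
  rewrite (_ : (fun k => _) = (fun k => sqrt_iter B k j i)); first exact: cY.
  by apply/funext => k; rewrite -[in LHS](pY k).1 mxE.
have cqY v : (fun k => qf (sqrt_iter B k) v) @ \oo --> qf Y v.
  rewrite qf_bf bfE (_ : (fun k => _) = (fun k => \sum_i \sum_j
     v i ord0 * sqrt_iter B k i j * v j ord0)); last first.
    by apply/funext => k; rewrite qf_bf bfE.
  apply: cvgn_sum => i; apply: cvgn_sum => j.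
  by apply: cvgM; [apply: cvgM => //; exact: cvg_cst | exact: cvg_cst].
have qY1 v : qf Y v <= qf 1%:M v.
  by apply: (cvgr_to_le (cqY v)); apply: nearW => k; exact: sqrt_iter_le1.
have fix_ : Y = 2^-1 *: (B + Y *m Y).
  apply/matrixP => i j; have -> : (2^-1 *: (B + Y *m Y)) i j =
      2^-1 * (B i j + \sum_l Y i l * Y l j) by rewrite !mxE.
  have c1 : (fun k => sqrt_iter B k.+1 i j) @ \oo --> Y i j.
    by rewrite (cvg_shiftS (fun k => sqrt_iter B k i j)); exact: cY.
  have c2 : (fun k => sqrt_iter B k.+1 i j) @ \oo -->
      2^-1 * (B i j + \sum_l Y i l * Y l j).
    rewrite (_ : (fun k => _) = (fun k => 2^-1 * (B i j +
      \sum_l sqrt_iter B k i l * sqrt_iter B k l j))); last first.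
      by apply/funext => k; rewrite sqrt_iterS mxE [X in _ * X = _]mxE [X in _ * (_ + X) = _]mxE.
    apply: cvgM; first exact: cvg_cst.
    apply: cvgD; first exact: cvg_cst.
    by apply: cvgn_sum => l; apply: cvgM; exact: cY.
  by rewrite -(cvg_lim _ c1) // (cvg_lim _ c2).
pose S := 1%:M - Y.
have SS : S *m S = A.
  rewrite mulmxBl !mulmxBr !mul1mx !mulmx1.
  have : 2 *: Y = B + Y *m Y by rewrite {1}fix_ scalerA mulfV ?scale1r ?pnatr_eq0.
  have BA : A = 1%:M - B by rewrite /B subKr.
  rewrite BA scaler_nat mulr2n => e; rewrite -[Y *m Y](addKr B) -e.
  by apply/matrixP => i j; rewrite !mxE; ring.
have sS : Defs.symmetricmx S by rewrite /Defs.symmetricmx linearB /= trmx1 sY.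
exists S => //; split=> // v v0.
have pS : psd S by split=> // w; rewrite qfBm subr_ge0.
(* If v^T S v = 0, Cauchy-Schwarz between v and Sv forces v^T A v = 0, so definiteness of A passes
   to S. *)
rewrite lt_def pS.2 andbT; apply: contraNneq v0 => q0.
have := psd_cauchy_schwarz v (S *m v) pS; rewrite q0 mul0r.
have -> : bf S v (S *m v) = qf A v.
  by rewrite /bf /qf -SS !mulmxA.
have [//|/pA.2 q] := eqVneq v 0.
by rewrite leNgt exprn_gt0.
Qed.

End SquareRoot.

Section MatrixSqrt.
Context {R : realType} {d : nat}.
Implicit Types (A L S : 'M[R]_d).

Lemma msqrt_spec A : spd A -> spd (msqrt A) /\ msqrt A *m msqrt A = A.
Proof.
move=> pA; suff : exists S, spd S /\ S *m S = A.
  by move=> [S hS]; apply: (@xgetPex _ 0 [set T | spd T /\ T *m T = A]); exists S.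
(* Size zero is treated apart: evaluating polynomials at a matrix requires positive size. *)
case: d A pA => [|m] A pA.
  exists A; split=> //; apply/matrixP; case=> //.
have [C C0 hC] := qf_bound A.
(* Scaling brings A below the identity; the root is scaled back by the square root of C. *)
have C1 : 0 < C^-1 by rewrite invr_gt0.
have lA v : qf (C^-1 *: A) v <= qf 1%:M v.
  by rewrite qfZm ler_pdivrMl.
have [S pS SS] := psd_sqrt_le1 (spd_scale C1 pA) lA.
exists (Num.sqrt C *: S); split; first by apply: spd_scale => //; rewrite sqrtr_gt0.
rewrite -scalemxAl -scalemxAr scalerA SS -expr2 sqr_sqrtr ?ltW //.
by rewrite scalerA mulfV ?scale1r ?gt_eqF.
Qed.

(** With S = L^{-1/2}, the substitution x = S y turns the L-norm of x into the Euclidean norm of y.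
    Any positive definite S with S^2 = L^-1 serves, so uniqueness of the root does not matter. *)
Lemma lambda_max_relative A L x : Defs.symmetricmx A -> spd L ->
  qf A x <=
    lambda_max (msqrt (invmx L) *m A *m msqrt (invmx L)) * qf L x.
Proof.
move=> sA pL; have [pS SS] := msqrt_spec (spd_invmx pL).
set S := msqrt _ in pS SS *; have uS := spd_unitmx pS; have uL := spd_unitmx pL.
have LE : L = invmx S *m invmx S.
  by rewrite -[invmx S *m _]mul1mx -(mulmxV uL) -SS !mulmxA !mulmxK.
have sS : S^T = S := pS.1.
rewrite -{1}(mulKVmx uS x) qf_conj sS.
rewrite [in qf L x]LE; have -> : qf (invmx S *m invmx S) x = qf 1%:M (invmx S *m x).
  by rewrite qf_conj trmx_inv sS mulmx1.
apply: lambda_max_ub.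
by rewrite /Defs.symmetricmx !trmx_mul sS sA mulmxA.
Qed.

End MatrixSqrt.

(** * Independence of generated sigma-algebras *)

Section GeneratedIndependence.
Context {R : realType} {dO : measure_display} {O : measurableType dO}.
Variables (P : probability O R) (I : eqType) (F : I -> set (set O)).
Hypothesis Fm : forall i, F i `<=` measurable.
Hypothesis FT : forall i, F i setT.
Hypothesis FI : forall i, setI_closed (F i).
Hypothesis indF : mutually_independent P F.

(** A pi-system for the information carried by the indices in [J]. Sets [B i] are chosen for all
    [i], so that families over different lists can be compared by filling in [setT]. *)
Definition cylinder (J : seq I) : set (set O) :=
  [set A | exists B : I -> set O,
     (forall i, F i (B i)) /\ A = \bigcap_(j in [set` J]) B j].

Lemma cylinderT J : cylinder J setT.
Proof. by exists (fun=> setT); split=> //; rewrite bigcapT. Qed.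

Lemma cylinderI J : setI_closed (cylinder J).
Proof.
move=> _ _ [B [FB ->]] [C [FC ->]]; exists (fun i => B i `&` C i).
by split=> [i|]; [exact: FI | rewrite bigcapI].
Qed.

Lemma cylinder_measurable J : cylinder J `<=` measurable.
Proof.
move=> _ [B [FB ->]]; elim: J => [|j J IH].
  by rewrite (_ : \bigcap_(j in _) _ = setT) //; apply/seteqP; split=> // x _ i.
rewrite (_ : \bigcap_(j in _) _ = B j `&` \bigcap_(j in [set` J]) B j).
  by apply: measurableI => //; apply: Fm; exact: FB.
apply/seteqP; split=> [x h|x [hj h] i /=].
  by split=> [|i iJ]; apply: h; rewrite /= inE ?eqxx // (_ : i \in J) ?orbT.
by rewrite inE => /predU1P[->|] //; exact: h.
Qed.

Lemma sub_cylinder J j A : j \in J -> F j A -> cylinder J A.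
Proof.
move=> jJ FA; exists (fun i => if i == j then A else setT); split.
  by move=> i; case: eqP => [->|].
apply/seteqP; split=> [x Ax i _ /=|x /(_ j jJ)]; first by case: eqP.
by rewrite eqxx.
Qed.

Lemma cylinder_sub J1 J2 : {subset J1 <= J2} -> cylinder J1 `<=` cylinder J2.
Proof.
move=> s _ [B [FB ->]]; exists (fun i => if i \in J1 then B i else setT).
split=> [i|]; first by case: ifP.
apply/seteqP; split=> [x h i _ /=|x h i /= iJ].
  by case: ifP => // /h.
by have := h i (s _ iJ); rewrite iJ.
Qed.

(** The two families are glued into one over the concatenated lists, where mutual independence
    applies; duplicates are removed since it speaks of lists without repetition. *)
Lemma cylinder_indep J1 J2 A B : (forall i, i \in J1 -> i \notin J2) ->
  cylinder J1 A -> cylinder J2 B -> P (A `&` B) = (P A * P B)%E.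
Proof.
move=> dJ [C [FC ->]] [D [FD ->]].
have undupE (J : seq I) : [set` J] = [set` undup J].
  by apply/seteqP; split=> x /=; rewrite mem_undup.
rewrite (undupE J1) (undupE J2); set K1 := undup J1; set K2 := undup J2.
have d12 i : i \in K2 -> i \notin K1.
  by rewrite !mem_undup => i2; apply/negP => /dJ; rewrite i2.
pose G i := if i \in K1 then C i else D i.
have FG i : F i (G i) by rewrite /G; case: ifP.
have -> : \bigcap_(j in [set` K1]) C j `&` \bigcap_(j in [set` K2]) D j =
    \bigcap_(j in [set` K1 ++ K2]) G j.
  apply/seteqP; split=> [x [hC hD] i /=|x h].
    rewrite mem_cat /G; case: ifP => [i1 _|_ /= i2]; first exact: hC.
    exact: hD.
  split=> i /= iK.
    by have := h i; rewrite /= mem_cat iK /G iK; apply.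
  by have := h i; rewrite /= mem_cat iK orbT /G (negPf (d12 _ iK)); apply.
have uK : uniq (K1 ++ K2).
  rewrite cat_uniq !undup_uniq /= andbT; apply/hasPn => i; exact: d12.
rewrite indF // big_cat /= !indF ?undup_uniq //; congr (_ * _)%E.
  by apply: eq_big_seq => i i1; rewrite /G i1.
by apply: eq_big_seq => i i2; rewrite /G (negPf (d12 _ i2)).
Qed.

Lemma sigma_cylinder_measurable J : <<s cylinder J >> `<=` measurable.
Proof. by apply: smallest_sub; [exact: sigma_algebra_measurable | exact: cylinder_measurable]. Qed.

(** For fixed B, both P(A & B) and P(A) P(B) are finite measures in A. They agree on a pi-system
    containing the whole space, hence on the sigma-algebra it generates. *)
Let indep_extend (G : set (set O)) B : measurable B ->
  G `<=` measurable -> G setT -> setI_closed G ->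
  (forall A, G A -> P (A `&` B) = (P A * P B)%E) ->
  forall A, <<s G >> A -> P (A `&` B) = (P A * P B)%E.
Proof.
move=> mB Gm GT GI h A sA.
have pB : P B \is a fin_num by exact: fin_num_measure.
have pB0 : 0 <= fine (P B) by rewrite fine_ge0.
have scaleE C : mscale (NngNum pB0) P C = (P C * P B)%E.
  by rewrite /mscale /= fineK // muleC.
rewrite -scaleE -[LHS]/(mrestr P mB A).
apply: (@g_sigma_algebra_measure_unique _ R O G Gm (fun=> setT)) => //.
- by rewrite bigcup_const //; exists 0%N.
- by move=> C GC; have := h C GC; rewrite -scaleE.
- by move=> _; rewrite /= /mrestr setTI ltey_eq pB.
Qed.

Lemma sigma_cylinder_indep J1 J2 A B : (forall i, i \in J1 -> i \notin J2) ->
  <<s cylinder J1 >> A -> <<s cylinder J2 >> B ->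
  P (A `&` B) = (P A * P B)%E.
Proof.
move=> dJ sA sB.
apply: (indep_extend _ (@cylinder_measurable J1)) => //.
- exact: sigma_cylinder_measurable sB.
- exact: cylinderT.
- exact: cylinderI.
move=> C cC; rewrite setIC muleC.
apply: (indep_extend _ (@cylinder_measurable J2)) => //.
- exact: cylinder_measurable cC.
- exact: cylinderT.
- exact: cylinderI.
by move=> D cD; rewrite setIC muleC; exact: cylinder_indep cC cD.
Qed.

End GeneratedIndependence.

(** * Expectation of a product of independent variables *)

Section ProductExpectation.
Context {R : realType} {dO : measure_display} {O : measurableType dO}.
Variables (P : probability O R) (X Y : {mfun O >-> R}).
Hypothesis indXY : forall A B : set R, measurable A -> measurable B ->
  P (X @^-1` A `&` Y @^-1` B) = (P (X @^-1` A) * P (Y @^-1` B))%E.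
Hypothesis iX : P.-integrable setT (EFin \o X).
Hypothesis iY : P.-integrable setT (EFin \o Y).

Let mXY : (fun w => (X w, Y w)) \in (mfun : {pred O -> (R * R)%type}).
Proof. by rewrite inE; exact: measurable_fun_pair. Qed.

Let m1 := distribution P X.
Let m2 := distribution P Y.
Let m12 := distribution P (mfun_Sub mXY).

Let lawXY A : measurable A -> (m1 \x m2)%E A = m12 A.
Proof.
by move=> mA; apply: product_measure_unique => // B C mB mC; rewrite -indXY.
Qed.

Let h (z : R * R) : \bar R := (z.1 * z.2)%:E.
Let mh : measurable_fun setT h.
Proof.
by apply/measurable_EFinP; apply: measurable_funM.
Qed.

Local Open Scope ereal_scope.

(** Tonelli for |xy| under the product law: finiteness of the right side provides the integrability
    that Fubini needs for the signed product. *)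
Let abs_integral : \int[m1 \x m2]_z `|h z| =
  (\int[P]_w `|(X w)%:E|) * (\int[P]_w `|(Y w)%:E|).
Proof.
rewrite fubini_tonelli1 //; last exact: measurableT_comp.
have mX : measurable_fun setT (EFin \o X) by apply/measurable_EFinP.
have mY : measurable_fun setT (EFin \o Y) by apply/measurable_EFinP.
have mabs : measurable_fun setT (fun y : R => `|y%:E|).
  by apply: measurableT_comp => //; exact/measurable_EFinP.
transitivity (\int[m1]_x (`|x%:E| * \int[m2]_y `|y%:E|)).
  apply: eq_integral => x _; rewrite -ge0_integralZl //.
  by apply: eq_integral => y _; rewrite /h EFinM abseM.
rewrite ge0_integralZr //; last exact: integral_ge0.
by rewrite !ge0_integral_distribution.
Qed.

Lemma integrable_indepM : P.-integrable setT (fun w => (X w * Y w)%:E).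
Proof.
apply/integrableP; split; first exact/measurable_EFinP/measurable_funM.
have -> : \int[P]_w `|(X w * Y w)%:E| = \int[m12]_z `|h z|.
  by rewrite ge0_integral_distribution //; exact: measurableT_comp.
rewrite (eq_measure_integral (m1 \x m2)%E) => [|A mA _]; last exact/esym/lawXY.
rewrite abs_integral lte_mul_pinfty ?integral_ge0 //.
  by have /integrableP[] := iX; rewrite ge0_fin_numE ?integral_ge0.
by have /integrableP[] := iY.
Qed.

Lemma integral_indepM : \int[P]_w (X w * Y w)%:E =
  (\int[P]_w (X w)%:E) * (\int[P]_w (Y w)%:E).
Proof.
have i12 : (m1 \x m2).-integrable setT h.
  apply/integrableP; split=> //; rewrite abs_integral lte_mul_pinfty ?integral_ge0 //.
    by have /integrableP[] := iX; rewrite ge0_fin_numE ?integral_ge0.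
  by have /integrableP[] := iY.
have -> : \int[P]_w (X w * Y w)%:E = \int[m12]_z h z.
  by rewrite integral_distribution //; exact: integrable_indepM.
rewrite (eq_measure_integral (m1 \x m2)%E) => [|A mA _]; last exact/esym/lawXY.
rewrite -integral12_prod_meas1 //.
have fY : \int[m2]_y y%:E = \int[P]_w (Y w)%:E by rewrite integral_distribution.
have iY2 : m2.-integrable setT (EFin : R -> \bar R).
  by apply: integrable_pushforward.
have iX1 : m1.-integrable setT (EFin : R -> \bar R).
  by apply: integrable_pushforward.
have fin : \int[m2]_y y%:E \is a fin_num by exact: integrable_fin_num.
transitivity (\int[m1]_x (x%:E * \int[m2]_y y%:E)).
  apply: eq_integral => x _; rewrite -integralZl //.
rewrite -(fineK fin) integralZr // fineK // fY; congr (_ * _).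
by rewrite integral_distribution.
Qed.

End ProductExpectation.

(** * Square-integrable random variables and vectors *)

Section SquareIntegrable.
Context {R : realType} {dO : measure_display} {O : measurableType dO}.
Variable P : probability O R.
Implicit Types (X Y : O -> R) (G : set (set O)).

Definition real_integrable X := P.-integrable setT (EFin \o X).
Definition sq_integrable X :=
  measurable_fun setT X /\ real_integrable (fun w => X w ^+ 2).

Lemma real_integrable_meas X : real_integrable X -> measurable_fun setT X.
Proof. by move/integrableP => -[/measurable_EFinP]. Qed.

Lemma real_integrable_dom X Y : measurable_fun setT X ->
  (forall w, `|X w| <= Y w) -> real_integrable Y -> real_integrable X.
Proof.
move=> mX XY iY; apply: le_integrable iY => //; first exact/measurable_EFinP.
by move=> w _ /=; rewrite lee_fin (le_trans (XY w)) // ler_norm.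
Qed.

Lemma real_integrableD X Y : real_integrable X -> real_integrable Y ->
  real_integrable (fun w => X w + Y w).
Proof. by move=> iX iY; exact: (integrableD measurableT iX iY). Qed.

Lemma real_integrableZ a X : real_integrable X ->
  real_integrable (fun w => a * X w).
Proof. by move=> iX; exact: (integrableZl measurableT a iX). Qed.

Lemma real_integrable_sum I (r : seq I) (F : I -> O -> R) :
  (forall i, real_integrable (F i)) ->
  real_integrable (fun w => \sum_(i <- r) F i w).
Proof.
move=> iF; have := @integrable_sum _ _ _ P setT measurableT I r xpredT _ (fun i _ => iF i).
by apply: eq_integrable => // w _ /=; rewrite sumEFin.
Qed.

Lemma real_integrable_cst a : real_integrable (fun=> a).
Proof. exact: finite_measure_integrable_cst. Qed.

Lemma Rintegral_sum I (r : seq I) (F : I -> O -> R) :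
  (forall i, real_integrable (F i)) ->
  \int[P]_w (\sum_(i <- r) F i w) = \sum_(i <- r) \int[P]_w F i w.
Proof.
move=> iF; elim: r => [|i r IH].
  under eq_fun do rewrite big_nil.
  by rewrite big_nil Rintegral_cst // mul0r.
rewrite big_cons -IH -RintegralD //; [|exact: iF | exact: real_integrable_sum].
by under eq_fun do rewrite big_cons.
Qed.

Lemma sq_integrableM X Y : sq_integrable X -> sq_integrable Y ->
  real_integrable (fun w => X w * Y w).
Proof.
move=> [mX iX] [mY iY].
apply: real_integrable_dom (real_integrableD iX iY).
  exact: measurable_funM.
move=> w; rewrite ler_norml.
by apply/andP; split; have := sqr_ge0 (X w + Y w); have := sqr_ge0 (X w - Y w); nra.
Qed.

Lemma sq_integrable_dom C X Y : measurable_fun setT X ->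
  (forall w, X w ^+ 2 <= C * Y w) -> real_integrable Y -> sq_integrable X.
Proof.
move=> mX XY iY; split=> //; apply: real_integrable_dom (real_integrableZ C iY).
  exact: measurable_funX.
by move=> w; rewrite ger0_norm ?sqr_ge0.
Qed.

Lemma sq_integrableD X Y : sq_integrable X -> sq_integrable Y ->
  sq_integrable (fun w => X w + Y w).
Proof.
move=> [mX iX] [mY iY].
apply: (@sq_integrable_dom 2 _ (fun w => X w ^+ 2 + Y w ^+ 2)).
- exact: measurable_funD.
- by move=> w; have := sqr_ge0 (X w - Y w); nra.
- exact: real_integrableD.
Qed.

Lemma sq_integrableZ a X : sq_integrable X -> sq_integrable (fun w => a * X w).
Proof.
move=> [mX iX]; apply: (@sq_integrable_dom (a ^+ 2) _ (fun w => X w ^+ 2)) => //.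
  exact: measurable_funM.
by move=> w; rewrite exprMn.
Qed.

Lemma sq_integrable_cst a : sq_integrable (fun=> a).
Proof. by split=> //; exact: real_integrable_cst. Qed.

Lemma sq_integrable_sum I (r : seq I) (F : I -> O -> R) :
  (forall i, sq_integrable (F i)) ->
  sq_integrable (fun w => \sum_(i <- r) F i w).
Proof.
move=> iF; elim: r => [|i r IH].
  by under eq_fun do rewrite big_nil; exact: sq_integrable_cst.
by under eq_fun do rewrite big_cons; exact: sq_integrableD.
Qed.

Definition adapted G X :=
  @measurable_fun _ _ (g_sigma_algebraType G) R setT X.
Definition sigma_indep G1 G2 := forall A B,
  <<s G1 >> A -> <<s G2 >> B -> P (A `&` B) = (P A * P B)%E.

Lemma adaptedP G X :
  (forall B, measurable B -> <<s G >> (X @^-1` B)) -> adapted G X.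
Proof. by move=> h _ B mB; rewrite setTI; exact: h. Qed.

Lemma adapted_preimage G X B : adapted G X -> measurable B ->
  <<s G >> (X @^-1` B).
Proof. by move=> aX mB; have := aX measurableT B mB; rewrite setTI. Qed.

Lemma adapted_sub G1 G2 X : G1 `<=` G2 -> adapted G1 X -> adapted G2 X.
Proof.
move=> G12 aX; apply: adaptedP => B mB.
by apply: sub_smallest2r (adapted_preimage aX mB).
Qed.

Lemma adapted_meas G X : G `<=` measurable -> adapted G X -> measurable_fun setT X.
Proof.
move=> Gm aX _ B mB; rewrite setTI.
apply: (smallest_sub _ Gm) (adapted_preimage aX mB).
exact: sigma_algebra_measurable.
Qed.

Section Indep.
Variables G1 G2 : set (set O).
Hypothesis ind : sigma_indep G1 G2.

Lemma indep_integrableM X Y : adapted G1 X -> adapted G2 Y ->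
  real_integrable X -> real_integrable Y ->
  real_integrable (fun w => X w * Y w) /\
  \int[P]_w (X w * Y w) = \int[P]_w X w * \int[P]_w Y w.
Proof.
move=> aX aY iX iY.
have mX : X \in (mfun : {pred O -> R}) by rewrite inE; exact: real_integrable_meas.
have mY : Y \in (mfun : {pred O -> R}) by rewrite inE; exact: real_integrable_meas.
have h A B : measurable A -> measurable B ->
    P (mfun_Sub mX @^-1` A `&` mfun_Sub mY @^-1` B) =
    (P (mfun_Sub mX @^-1` A) * P (mfun_Sub mY @^-1` B))%E.
  by move=> mA mB; apply: ind; apply: adapted_preimage.
split; first exact: (integrable_indepM h).
rewrite /Rintegral (integral_indepM h) // fineM //.
  exact: integrable_fin_num.
exact: integrable_fin_num.
Qed.

(** Independence stands in for fourth moments: the squares are independent and integrable, so their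
    product is integrable. *)
Lemma indep_sq_integrableM X Y : adapted G1 X -> adapted G2 Y ->
  sq_integrable X -> sq_integrable Y -> sq_integrable (fun w => X w * Y w).
Proof.
move=> aX aY [mX iX] [mY iY]; split; first exact: measurable_funM.
under eq_fun do rewrite exprMn.
have aX2 : adapted G1 (fun w => X w ^+ 2) by apply: measurable_funX.
have aY2 : adapted G2 (fun w => Y w ^+ 2) by apply: measurable_funX.
by have [] := indep_integrableM aX2 aY2 iX iY.
Qed.

End Indep.
End SquareIntegrable.

(** * Random vectors and independent increments *)

Section RandomVectors.
Context {R : realType} {dO : measure_display} {O : measurableType dO}.
Variable P : probability O R.
Context {d : nat}.
Implicit Types (Y U : O -> 'cV[R]_d) (M : O -> 'M[R]_d) (G : set (set O)).

Definition vsq Y := forall a, sq_integrable P (fun w => Y w a ord0).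
Definition vadapted G Y := forall a, adapted G (fun w => Y w a ord0).

Lemma vsqD Y U : vsq Y -> vsq U -> vsq (fun w => Y w + U w).
Proof. by move=> sY sU a; under eq_fun do rewrite mxE; exact: sq_integrableD. Qed.

Lemma vsqZ k Y : vsq Y -> vsq (fun w => k *: Y w).
Proof. by move=> sY a; under eq_fun do rewrite mxE; exact: sq_integrableZ. Qed.

Lemma vsqB Y U : vsq Y -> vsq U -> vsq (fun w => Y w - U w).
Proof.
move=> sY sU; under eq_fun do rewrite -scaleN1r.
by apply: vsqD => //; exact: vsqZ.
Qed.

Lemma vsq_cst y : vsq (fun=> y).
Proof. by move=> a; exact: sq_integrable_cst. Qed.

Lemma vsq_sum I (r : seq I) (F : I -> O -> 'cV[R]_d) :
  (forall i, vsq (F i)) -> vsq (fun w => \sum_(i <- r) F i w).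
Proof.
by move=> sF a; under eq_fun do rewrite summxE; apply: sq_integrable_sum => i; exact: sF.
Qed.

Lemma vsq_mulmx (A : 'M[R]_d) Y : vsq Y -> vsq (fun w => A *m Y w).
Proof.
move=> sY a; under eq_fun do rewrite mxE.
by apply: sq_integrable_sum => i; exact: sq_integrableZ.
Qed.

Lemma vadaptedD G Y U : vadapted G Y -> vadapted G U ->
  vadapted G (fun w => Y w + U w).
Proof.
move=> sY sU a; under eq_fun do rewrite mxE.
by apply: measurable_funD; [exact: sY | exact: sU].
Qed.

Lemma vadaptedZ G k Y : vadapted G Y -> vadapted G (fun w => k *: Y w).
Proof.
move=> sY a; under eq_fun do rewrite mxE.
by apply: measurable_funM => //; exact: sY.
Qed.

Lemma vadaptedB G Y U : vadapted G Y -> vadapted G U ->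
  vadapted G (fun w => Y w - U w).
Proof.
move=> sY sU; under eq_fun do rewrite -scaleN1r.
by apply: vadaptedD => //; exact: vadaptedZ.
Qed.

Lemma vadapted_cst G y : vadapted G (fun=> y).
Proof. by move=> a; exact: measurable_cst. Qed.

Lemma vadapted_sum G I (r : seq I) (F : I -> O -> 'cV[R]_d) :
  (forall i, vadapted G (F i)) -> vadapted G (fun w => \sum_(i <- r) F i w).
Proof.
move=> sF a; under eq_fun do rewrite summxE.
by apply: measurable_sum => i; exact: sF.
Qed.

Lemma vadapted_mulmx G M Y : (forall a b, adapted G (fun w => M w a b)) ->
  vadapted G Y -> vadapted G (fun w => M w *m Y w).
Proof.
move=> sM sY a; under eq_fun do rewrite mxE.
by apply: measurable_sum => i; apply: measurable_funM; [exact: sM | exact: sY].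
Qed.

Lemma vadapted_sub G1 G2 Y : G1 `<=` G2 -> vadapted G1 Y -> vadapted G2 Y.
Proof. by move=> G12 aY a; apply: adapted_sub (aY a). Qed.

Lemma adapted_qf G (A : 'M[R]_d) Y : vadapted G Y ->
  adapted G (fun w => qf A (Y w)).
Proof.
move=> aY; under eq_fun do rewrite qf_bf bfE.
apply: measurable_sum => i; apply: measurable_sum => j.
by apply: measurable_funM; [apply: measurable_funM => //|]; exact: aY.
Qed.

Lemma real_integrable_qf (A : 'M[R]_d) Y : vsq Y ->
  real_integrable P (fun w => qf A (Y w)).
Proof.
move=> sY; under eq_fun do rewrite qf_bf bfE.
apply: real_integrable_sum => i; apply: real_integrable_sum => j.
under eq_fun do rewrite mulrAC mulrC.
by apply: real_integrableZ; exact: sq_integrableM.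
Qed.

(* Conditionally on [Y] and [U], the increment [M U] is centred, so the cross
   term vanishes. *)
Lemma indep_step G1 G2 (A : 'M[R]_d) Y U M :
  sigma_indep P G1 G2 ->
  Defs.symmetricmx A ->
  vadapted G1 Y -> vadapted G1 U -> vsq Y -> vsq U ->
  (forall a b, adapted G2 (fun w => M w a b)) ->
  (forall a b, sq_integrable P (fun w => M w a b)) ->
  (forall a b, \int[P]_w M w a b = 0) ->
  vsq (fun w => M w *m U w) /\
  \int[P]_w qf A (Y w + M w *m U w) = \int[P]_w qf A (Y w) +
    \int[P]_w qf (\matrix_(a, b) \int[P]_w ((M w)^T *m A *m M w) a b) (U w).
Proof.
move=> ind sA aY aU sY sU aM sM M0.
have sMU : vsq (fun w => M w *m U w).
  move=> a; under eq_fun do rewrite mxE.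
  apply: sq_integrable_sum => b; under eq_fun do rewrite mulrC.
  exact: (indep_sq_integrableM ind (aU b) (aM a b) (sU b) (sM a b)).
split=> //.
have intM a b : real_integrable P (fun w => M w a b).
  have := sq_integrableM (sM a b) (sq_integrable_cst P 1).
  by under eq_fun do rewrite mulr1.
have cross : real_integrable P (fun w => bf A (Y w) (M w *m U w)) /\
    \int[P]_w bf A (Y w) (M w *m U w) = 0.
  (* Each term is grouped as a past factor Y_i U_l times a fresh centred entry of M. *)
  pose t i j l w := A i j * ((Y w i ord0 * U w l ord0) * M w j l).
  have tE : (fun w => bf A (Y w) (M w *m U w)) =
      (fun w => \sum_i \sum_j \sum_l t i j l w).
    apply/funext => w; rewrite bfE; apply: eq_bigr => i _; apply: eq_bigr => j _.
    by rewrite mxE mulr_sumr; apply: eq_bigr => l _; rewrite /t; ring.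
  have ht i j l : real_integrable P (fun w => (Y w i ord0 * U w l ord0) * M w j l) /\
      \int[P]_w ((Y w i ord0 * U w l ord0) * M w j l) = 0.
    have [] := indep_integrableM ind (Y := fun w => M w j l)
        (measurable_funM (aY i) (aU l)) (aM j l) (sq_integrableM (sY i) (sU l)) (intM j l).
    by rewrite M0 mulr0.
  have it i j l : real_integrable P (t i j l).
    by apply: real_integrableZ; exact: (ht i j l).1.
  rewrite tE; split.
    by do 3 (apply: real_integrable_sum => ?).
  rewrite Rintegral_sum => [|i]; last by do 2 (apply: real_integrable_sum => ?).
  rewrite big1 // => i _; rewrite Rintegral_sum => [|j]; last exact: real_integrable_sum.
  rewrite big1 // => j _; rewrite Rintegral_sum => [|l]; last exact: it.
  rewrite big1 // => l _; rewrite RintegralZl ?(ht i j l).2 ?mulr0 //.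
  exact: (ht i j l).1.
have quad : \int[P]_w qf A (M w *m U w) =
    \int[P]_w qf (\matrix_(a, b) \int[P]_w ((M w)^T *m A *m M w) a b) (U w).
  (* The fresh matrix M^T A M separates entrywise from the past products U_a U_b, so it may be
     replaced by its mean. *)
  pose N w := (M w)^T *m A *m M w.
  have aN a b : adapted G2 (fun w => N w a b).
    under eq_fun do rewrite mxE; apply: measurable_sum => j.
    apply: measurable_funM; last exact: aM.
    under eq_fun do rewrite mxE; apply: measurable_sum => i.
    by apply: measurable_funM => //; under eq_fun do rewrite mxE; exact: aM.
  have iN a b : real_integrable P (fun w => N w a b).
    under eq_fun do rewrite mxE; apply: real_integrable_sum => j.
    under eq_fun do rewrite mxE mulr_suml; apply: real_integrable_sum => i.
    under eq_fun do rewrite mxE mulrAC mulrC.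
    by apply: real_integrableZ; exact: sq_integrableM.
  have hN a b : real_integrable P (fun w => (U w a ord0 * U w b ord0) * N w a b) /\
      \int[P]_w ((U w a ord0 * U w b ord0) * N w a b) =
      \int[P]_w (U w a ord0 * U w b ord0) * \int[P]_w N w a b.
    exact: (indep_integrableM ind (measurable_funM (aU a) (aU b)) (aN a b)
      (sq_integrableM (sU a) (sU b)) (iN a b)).
  have -> : (fun w => qf A (M w *m U w)) =
      (fun w => \sum_a \sum_b (U w a ord0 * U w b ord0) * N w a b).
    apply/funext => w; rewrite qf_conj qf_bf bfE.
    by apply: eq_bigr => a _; apply: eq_bigr => b _; rewrite mulrAC.
  under [in RHS]eq_fun do rewrite qf_bf bfE.
  rewrite !Rintegral_sum.
  - apply: eq_bigr => a _; rewrite !Rintegral_sum.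
    + apply: eq_bigr => b _; rewrite (hN a b).2.
      under [in RHS]eq_fun do rewrite mulrAC mxE.
      rewrite RintegralZr //; exact: sq_integrableM.
    + move=> b; under eq_fun do rewrite mulrAC mulrC.
      by apply: real_integrableZ; exact: sq_integrableM.
    + by move=> b; exact: (hN a b).1.
  - move=> a; apply: real_integrable_sum => b; under eq_fun do rewrite mulrAC mulrC.
    by apply: real_integrableZ; exact: sq_integrableM.
  - by move=> a; apply: real_integrable_sum => b; exact: (hN a b).1.
under eq_fun do rewrite qfD //.
rewrite -quad RintegralD //; last exact: real_integrable_qf.
  rewrite RintegralD //.
  - by rewrite RintegralZl //; [rewrite cross.2 mulr0 addr0 | exact: cross.1].
  - exact: real_integrable_qf.
  - by apply: real_integrableZ; exact: cross.1.
apply: real_integrableD; first exact: real_integrable_qf.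
by apply: real_integrableZ; exact: cross.1.
Qed.

Section IndependentSum.
Variables (I : eqType) (F : I -> set (set O)).
Hypothesis Fm : forall i, F i `<=` measurable.
Hypothesis FT : forall i, F i setT.
Hypothesis FI : forall i, setI_closed (F i).
Hypothesis indF : mutually_independent P F.

(** Induction on [s]: the matrices already added join the past, and the index of the next one is
    still outside it because [s] has no repetition and [j] is injective. The vectors [U t] depend on
    [J0] alone, hence remain measurable for the growing past. *)
Lemma indep_sum (A : 'M[R]_d) (J0 : seq I) (T : eqType) (j : T -> I) (s : seq T) Y
    (U : T -> O -> 'cV[R]_d) (M : T -> O -> 'M[R]_d) :
  injective j -> (forall t, j t \notin J0) -> uniq s ->
  Defs.symmetricmx A ->
  vadapted (cylinder F J0) Y -> (forall t, vadapted (cylinder F J0) (U t)) ->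
  vsq Y -> (forall t, vsq (U t)) ->
  (forall t a b, adapted (cylinder F [:: j t]) (fun w => M t w a b)) ->
  (forall t a b, sq_integrable P (fun w => M t w a b)) ->
  (forall t a b, \int[P]_w M t w a b = 0) ->
  let Z w := Y w + \sum_(t <- s) M t w *m U t w in
  [/\ vsq Z, vadapted (cylinder F (J0 ++ map j s)) Z &
    \int[P]_w qf A (Z w) = \int[P]_w qf A (Y w) + \sum_(t <- s)
      \int[P]_w qf (\matrix_(a, b) \int[P]_w ((M t w)^T *m A *m M t w) a b) (U t w)].
Proof.
move=> inj jJ + sA aY aU sY sU aM sM M0.
elim: s => [_|t s IH /= /andP[ts us]] /=.
  have -> : (fun w => Y w + \sum_(t <- [::]) M t w *m U t w) = Y.
    by apply/funext => w; rewrite big_nil addr0.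
  rewrite big_nil addr0 cats0; split=> //.
  by under eq_fun do rewrite big_nil addr0.
have [sZ aZ EZ] := IH us.
set Z := (fun w => Y w + \sum_(t <- s) M t w *m U t w) in sZ aZ EZ.
have -> : (fun w => Y w + \sum_(t' <- t :: s) M t' w *m U t' w) =
    (fun w => Z w + M t w *m U t w).
  by apply/funext => w; rewrite /Z big_cons addrA addrAC.
have sub0 J1 J2 : {subset J1 <= J2} -> cylinder F J1 `<=` cylinder F J2.
  exact: cylinder_sub.
have ind : sigma_indep P (cylinder F (J0 ++ map j s)) (cylinder F [:: j t]).
  move=> B C; apply: sigma_cylinder_indep => // i.
  rewrite mem_cat inE => /orP[i0|/mapP[t' t's ->]].
    by apply: contraNneq (jJ t) => <-.
  by rewrite inj_eq //; apply: contraNneq ts => <-.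
have aU' : vadapted (cylinder F (J0 ++ map j s)) (U t).
  by apply: vadapted_sub (aU t); apply: sub0 => i; rewrite mem_cat => ->.
have [sMU E] := indep_step ind sA aZ aU' sZ (sU t) (aM t) (sM t) (M0 t).
split.
- exact: vsqD.
- apply: vadaptedD.
    apply: vadapted_sub aZ; apply: sub0 => i.
    by rewrite !mem_cat inE => /orP[->|->]; rewrite ?orbT.
  apply: vadapted_mulmx.
    move=> a b; apply: adapted_sub (aM t a b); apply: sub0 => i.
    by rewrite inE => /eqP ->; rewrite mem_cat inE eqxx orbT.
  by apply: vadapted_sub (aU t); apply: sub0 => i; rewrite mem_cat => ->.
- under eq_fun do rewrite big_cons addrA addrAC.
  by rewrite E EZ big_cons -addrA [X in _ + X]addrC.
Qed.

End IndependentSum.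
End RandomVectors.

(** * Gradients and descent *)

Section Gradient.
Context {R : realType} {d : nat}.
Implicit Types (h : 'cV[R]_d -> R) (x y v : 'cV[R]_d) (L : 'M[R]_d).

Lemma derive_grad h x v : differentiable h x ->
  'D_v h x = bf 1%:M (grad h x) v.
Proof.
move=> dh; rewrite deriveE // /bf mulmx1 mxE.
have -> : v = \sum_j v j ord0 *: delta_mx j ord0.
  apply/colP => i; rewrite summxE (bigD1 i) //= !mxE !eqxx mulr1 big1 ?addr0 // => j ji.
  by rewrite !mxE eq_sym (negPf ji) mulr0.
rewrite linear_sum; apply: eq_bigr => j _; rewrite linearZ /= !mxE deriveE // mulrC.
congr (_ * _); rewrite summxE (bigD1 j) //= !mxE !eqxx mulr1 big1 ?addr0 // => i ij.
by rewrite !mxE eq_sym (negPf ij) mulr0.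
Qed.

Lemma grad_mean n (g : 'I_n -> 'cV[R]_d -> R) (a : R) x :
  (forall i, differentiable (g i) x) ->
  grad (fun y => a * \sum_(i < n) g i y) x = a *: \sum_(i < n) grad (g i) x.
Proof.
move=> dg; apply/colP => j; rewrite !mxE summxE.
have -> : (fun y => a * \sum_(i < n) g i y) = a \*: (\sum_(i < n) g i).
  by apply/funext => y /=; rewrite fct_sumE.
have dv i : derivable (g i) x (delta_mx j ord0) by exact: diff_derivable.
rewrite deriveZ; last exact: derivable_sum.
by rewrite derive_sum //; congr (_ * _); apply: eq_bigr => i _; rewrite mxE.
Qed.

Lemma differentiable_mean n (g : 'I_n -> 'cV[R]_d -> R) (a : R) x :
  (forall i, differentiable (g i) x) ->
  differentiable (fun y => a * \sum_(i < n) g i y) x.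
Proof.
move=> dg; have -> : (fun y => a * \sum_(i < n) g i y) = a \*: (\sum_(i < n) g i).
  by apply/funext => y /=; rewrite fct_sumE.
by apply: differentiableZ; exact: differentiable_sum.
Qed.

Lemma lipschitz_grad_qf L h x y : spd L -> lipschitz_grad L h ->
  qf (invmx L) (grad h x - grad h y) <= qf L (x - y).
Proof.
move=> pL lh; have q0 := psd_ge0 (x - y) (spd_psd pL).
by have := lh x y; rewrite /mnorm ler_sqrt.
Qed.

(** Duality of the L^-1 and L norms: Cauchy-Schwarz in the L^-1-form between x and Ly. *)
Lemma bf1_dual L x y : spd L ->
  bf 1%:M x y ^+ 2 <= qf (invmx L) x * qf L y.
Proof.
move=> pL; have uL := spd_unitmx pL.
have := psd_cauchy_schwarz x (L *m y) (spd_psd (spd_invmx pL)).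
rewrite (qf_invmx (L *m y)) // mulKmx //.
by rewrite /bf mulmx1 mulmxA mulmxKV.
Qed.

Lemma is_derive_segment h x v (t : R) : differentiable h (x + t *: v) ->
  is_derive t (1 : R) (fun s : R => h (x + s *: v)) ('D_v h (x + t *: v)).
Proof.
move=> dh; have dv := diff_derivable (v := v) dh.
have E : (fun s : R => s^-1 *: (((fun s : R => h (x + s *: v)) \o shift t) (s *: (1 : R)) -
    h (x + t *: v))) = (fun s : R => s^-1 *: ((h \o shift (x + t *: v)) (s *: v) - h (x + t *: v))).
  apply/funext => s /=; congr (_ *: (h _ - _)).
  by rewrite [s *: 1]mulr1 scalerDl addrCA.
by apply: DeriveDef; rewrite /derivable /derive E.
Qed.

(** The mean value theorem is applied to h(x - s g) + c s - q s^2 / 2 on [0, 1]. Its derivative is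
    nonpositive: the gradient increment paired with g is at most q s, by duality and the Lipschitz
    bound. *)
Lemma descent_lemma L h x g : spd L -> (forall y, differentiable h y) ->
  lipschitz_grad L h ->
  h (x - g) <= h x - bf 1%:M (grad h x) g + 2^-1 * qf L g.
Proof.
move=> pL dh lh; set c := bf _ _ _; set q := qf L g.
have q0 : 0 <= q by exact: psd_ge0 (spd_psd pL).
pose pol : {poly R} := c *: 'X - (2^-1 * q) *: 'X^2.
pose psi := (fun s : R => h (x + s *: (- g))) + horner pol.
pose dpsi t := - bf 1%:M (grad h (x + t *: (- g))) g + (c - q * t).
have dP t : is_derive t (1 : R) psi (dpsi t).
  have i1 := is_derive_segment (dh (x + t *: (- g))).
  apply: is_derive_eq.
  rewrite derive_grad // bfNr /dpsi; congr (_ + _).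
  rewrite /pol derivB !derivZ derivX derivXn !hornerE /=.
  by field.
have cpsi : {within `[0, 1], continuous psi}.
  by apply: derivable_within_continuous => t _; exact: ex_derive.
have [t /andP[t0 t1]] := MVT ltr01 (fun t _ => dP t) cpsi.
rewrite subr0 mulr1 /psi !fctE /pol !hornerE /= scale1r scale0r (addr0 x).
have le0 : dpsi t <= 0.
  have -> : dpsi t = bf 1%:M (grad h x - grad h (x + t *: (- g))) g - q * t.
    by rewrite /dpsi -[- grad h _]scaleN1r bfDl bfZl /c; ring.
  rewrite subr_le0; apply: (le_trans (ler_norm _)).
  have tq : 0 <= q * t by rewrite mulr_ge0 // ltW.
  rewrite -ler_sqr ?nnegrE // real_normK ?num_real //.
  apply: (le_trans (bf1_dual _ _ pL)).
  have := lipschitz_grad_qf x (x + t *: (- g)) pL lh.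
  rewrite opprD addNKr scalerN opprK qfZ -/q => hq.
  by apply: (le_trans (ler_wpM2r q0 hq)); rewrite exprMn; nra.
by move=> e; rewrite -/q; lra.
Qed.

(* Polarization of [|g - D grad h x|^2] in the [D^-1]-norm. *)
Lemma preconditioned_descent L D h x g : spd L -> spd D ->
  (forall y, differentiable h y) -> lipschitz_grad L h ->
  h (x - g) <= h x + (- 2^-1 * qf D (grad h x)
    + 2^-1 * qf (invmx D) (g - D *m grad h x)
    + 2^-1 * (qf L g - qf (invmx D) g)).
Proof.
move=> pL pD dh lh; apply: (le_trans (descent_lemma _ _ pL dh lh)).
have uD := spd_unitmx pD; have symD : D^T = D by case: pD.
have sDi : Defs.symmetricmx (invmx D) by case: (spd_invmx pD).
rewrite qfD // qfN bfNr qf_conj symD mulmxV // mul1mx.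
rewrite (_ : bf (invmx D) _ _ = bf 1%:M (grad h x) g); first by lra.
by rewrite bfC // /bf trmx_mul symD mulmxK // mulmx1.
Qed.

End Gradient.

(** The term v K / p makes the induction close: one step of the recursion lowers v / p by v, up to
    the l-term, and this pays for the new summand v K. *)
Lemma potential_sum {R : realType} (v l : nat -> R) (p a : R) K :
  0 < p -> v 0 = 0 -> (forall k, v k.+1 <= (1 - p) * (v k + a * l k)) ->
  \sum_(k < K) v k + v K / p <= (1 - p) * a / p * \sum_(k < K) l k.
Proof.
move=> p0 v0 vS; elim: K => [|K IH].
  by rewrite !big_ord0 v0 mul0r mulr0 addr0.
rewrite !big_ord_recr /= mulrDr.
have h : v K.+1 / p <= (1 - p) * (v K + a * l K) / p.
  by apply: ler_wpM2r; [rewrite invr_ge0 ltW | exact: vS].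
have e1 : (1 - p) * (v K + a * l K) / p = v K / p - v K + (1 - p) * a / p * l K.
  by field; rewrite gt_eqF.
by move: h IH; rewrite e1; lra.
Qed.

(** * Measurability of continuous functions of a random vector *)

Section ContinuousMeasurable.
Context {R : realType} {d : nat} {dT : measure_display} {T : measurableType dT}.

(** Measurability of [Y] is known coordinatewise only, so an open set is written as a countable
    union of boxes with rational centres and radii 1/(m+1). *)
Lemma measurable_preimage_open (Y : T -> 'cV[R]_d) (V : set 'cV[R]_d) :
  (forall a, measurable_fun setT (fun w => Y w a ord0)) -> open V ->
  measurable (Y @^-1` V).
Proof.
move=> mY oV.
pose box (z : 'cV[rat]_d * nat) : set 'cV[R]_d :=
  [set y | forall a, `|ratr (z.1 a ord0) - y a ord0| < (z.2.+1%:R : R)^-1].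
have mbox z : measurable (Y @^-1` box z).
  have -> : Y @^-1` box z = \bigcap_(a in [set: 'I_d])
      ((fun w => `|ratr (z.1 a ord0) - Y w a ord0|) @^-1` `]-oo, (z.2.+1%:R : R)^-1[).
    apply/seteqP; split=> [w h a _ /=|w h a].
      by rewrite in_itv /=; exact: h.
    by have := h a I; rewrite /= in_itv.
  apply: fin_bigcap_measurable => // a _; rewrite -[X in measurable X]setTI.
  apply: (measurableT_comp (@normr_measurable R setT)) => //.
  exact: measurable_funB.
have -> : Y @^-1` V = \bigcup_(z in [set z | box z `<=` V]) (Y @^-1` box z).
  apply/seteqP; split=> [w Vw|w [z /= zV bw]]; last exact: zV.
  have [e e0 he] : exists2 e : R, 0 < e & ball (Y w) e `<=` V.
    by have /nbhs_ballP[e e0 he] := open_nbhs_nbhs (conj oV Vw); exists e.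
  (* Two radii must fit into e: one from Y w to the rational centre, one from the centre to a point
     of the box. *)
  have [m me] : exists m : nat, (m.+1%:R : R)^-1 < e / 2.
    have e2 : 0 < e / 2 by rewrite divr_gt0.
    exists (Num.trunc (e / 2)^-1).
    by rewrite invf_plt ?posrE // -[X in _ < X]/(_) truncnS_gt.
  have mp : 0 < (m.+1%:R : R)^-1 by rewrite invr_gt0.
  have /choice[q hq] : forall a, exists q : rat,
      `|ratr q - Y w a ord0| < (m.+1%:R : R)^-1.
    move=> a; have /rat_in_itvoo[q] : Y w a ord0 - (m.+1%:R)^-1 < Y w a ord0 + (m.+1%:R)^-1.
      by rewrite ltrD2l (lt_trans _ mp) // oppr_lt0.
    by rewrite in_itv /= => qI; exists q; rewrite distrC ltr_distlC.
  exists (\col_a q a, m); last by move=> a; rewrite /= mxE; exact: hq.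
  move=> y /= hy; apply: he; split=> // i j; rewrite (ord1 j).
  have := hy i; rewrite /= mxE => h1; have h2 := hq i.
  rewrite /ball /= -(subrKA (ratr (q i))).
  apply: (le_lt_trans (ler_normD _ _)); rewrite distrC.
  by rewrite (splitr e); apply: ltrD; [exact: lt_trans me | exact: lt_trans me].
rewrite bigcup_mkcond; apply: countable_bigcupT_measurable => // z.
by case: ifP.
Qed.

Lemma measurable_fun_continuous_comp (Y : T -> 'cV[R]_d) (h : 'cV[R]_d -> R) :
  (forall a, measurable_fun setT (fun w => Y w a ord0)) -> continuous h ->
  measurable_fun setT (h \o Y).
Proof.
move=> mY ch; apply: (measurability (@RGenOpens.G R)).
  exact: RGenOpens.measurableE.
move=> _ [_ [a [b ->]] <-]; rewrite setTI comp_preimage.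
apply: measurable_preimage_open => //; move/continuousP : ch; apply.
exact: interval_open.
Qed.

End ContinuousMeasurable.

(** * Expectations of random matrices *)

Section Law.
Context {R : realType} {dO dX : measure_display} {O : measurableType dO}
  {X : measurableType dX}.
Variables (P : probability O R) (S : probability X R) (z : O -> X).
Hypothesis mz : measurable_fun setT z.
Hypothesis lawz : forall A, measurable A -> P (z @^-1` A) = S A.

Lemma law_integral (h : X -> R) : real_integrable S h ->
  real_integrable P (h \o z) /\ \int[P]_w h (z w) = \int[S]_y h y.
Proof.
move=> ih; have mh := real_integrable_meas ih.
have mz' : z \in (mfun : {pred O -> X}) by rewrite inE.
have lawE (k : X -> \bar R) :
    (\int[distribution P (mfun_Sub mz')]_y k y = \int[S]_y k y)%E.
  by apply: eq_measure_integral => A mA _; exact: lawz.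
have ihz : real_integrable P (h \o z).
  apply/integrableP; split; first by apply/measurable_EFinP; exact: measurableT_comp.
  have /integrableP[_] := ih; rewrite -lawE ge0_integral_distribution //.
  by apply: measurableT_comp => //; exact/measurable_EFinP.
split=> //; rewrite /Rintegral -lawE integral_distribution //.
exact/measurable_EFinP.
Qed.

End Law.

Section MatrixExpectation.
Context {R : realType} {dO : measure_display} {O : measurableType dO} {d : nat}.
Variable P : probability O R.

Lemma mexpectE (W : O -> 'M[R]_d) a b :
  mexpect P W a b = \int[P]_w W w a b.
Proof. by rewrite /mexpect mxE. Qed.

Lemma qf_mexpect (W : O -> 'M[R]_d) v :
  (forall a b, real_integrable P (fun w => W w a b)) ->
  qf (mexpect P W) v = \int[P]_w qf (W w) v.
Proof.
move=> iW; rewrite qf_bf bfE; under [in RHS]eq_fun do rewrite qf_bf bfE.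
have it a b : real_integrable P (fun w => v a ord0 * W w a b * v b ord0).
  by under eq_fun do rewrite mulrAC; exact: real_integrableZ.
rewrite Rintegral_sum => [|a]; last exact: real_integrable_sum.
apply: eq_bigr => a _; rewrite Rintegral_sum //; apply: eq_bigr => b _.
under [in RHS]eq_fun do rewrite mulrAC.
by rewrite mexpectE RintegralZl 1?mulrAC //; exact: iW.
Qed.

Lemma mexpect_mulmxl (A : 'M[R]_d) (W : O -> 'M[R]_d) :
  (forall a b, real_integrable P (fun w => W w a b)) ->
  (forall a b, real_integrable P (fun w => (A *m W w) a b)) /\
  mexpect P (fun w => A *m W w) = A *m mexpect P W.
Proof.
move=> iW; have it a b l : real_integrable P (fun w => A a l * W w l b).
  exact: real_integrableZ.
split=> [a b|]; first by under eq_fun do rewrite mxE; exact: real_integrable_sum.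
apply/matrixP => a b; rewrite mexpectE mxE; under eq_fun do rewrite mxE.
rewrite Rintegral_sum //; apply: eq_bigr => l _.
by rewrite mexpectE RintegralZl //; exact: iW.
Qed.

Lemma mexpect_mulmxr (A : 'M[R]_d) (W : O -> 'M[R]_d) :
  (forall a b, real_integrable P (fun w => W w a b)) ->
  (forall a b, real_integrable P (fun w => (W w *m A) a b)) /\
  mexpect P (fun w => W w *m A) = mexpect P W *m A.
Proof.
move=> iW; have it a b l : real_integrable P (fun w => W w a l * A l b).
  by under eq_fun do rewrite mulrC; exact: real_integrableZ.
split=> [a b|]; first by under eq_fun do rewrite mxE; exact: real_integrable_sum.
apply/matrixP => a b; rewrite mexpectE mxE; under eq_fun do rewrite mxE.
rewrite Rintegral_sum //; apply: eq_bigr => l _.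
by rewrite mexpectE RintegralZr //; exact: iW.
Qed.

Lemma mexpect_centered (A : 'M[R]_d) (T : O -> 'M[R]_d) :
  (forall w, Defs.symmetricmx (T w)) ->
  (forall a b, real_integrable P (fun w => T w a b)) ->
  (forall a b, sq_integrable P (fun w => T w a b)) ->
  mexpect P T = 1%:M ->
  let W w := (T w - 1%:M)^T *m A *m (T w - 1%:M) in
  (forall a b, real_integrable P (fun w => W w a b)) /\
  mexpect P W = mexpect P (fun w => T w *m A *m T w) - A.
Proof.
move=> sT iT sqT ET W.
have [iTA ETA] := mexpect_mulmxr A iT.
have [iAT EAT] := mexpect_mulmxl A iT.
have iTAT a b : real_integrable P (fun w => (T w *m A *m T w) a b).
  under eq_fun do rewrite mxE; apply: real_integrable_sum => l.
  under eq_fun do rewrite mxE mulr_suml; apply: real_integrable_sum => m.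
  under eq_fun do rewrite mulrAC mulrC.
  by apply: real_integrableZ; exact: sq_integrableM.
have WE w a b : W w a b = (T w *m A *m T w) a b +
    (-1 * (T w *m A) a b + (-1 * (A *m T w) a b + A a b)).
  have -> : W w = (T w - 1%:M) *m A *m (T w - 1%:M).
    by rewrite /W [(_ - _)^T]linearB /= trmx1 sT.
  rewrite !(mulmxBl, mulmxBr) !mulmx1 !mul1mx.
  by rewrite !mxE; ring.
have i2 a b := real_integrableD (real_integrableZ (-1) (iAT a b))
  (real_integrable_cst P (A a b)).
have i1 a b := real_integrableD (real_integrableZ (-1) (iTA a b)) (i2 a b).
split=> [a b|].
  by under eq_fun do rewrite WE; apply: real_integrableD.
apply/matrixP => a b; rewrite mexpectE [RHS]mxE mexpectE.
under eq_fun do rewrite WE.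
rewrite RintegralD; [|by []|exact: iTAT|exact: i1].
rewrite RintegralD; [|by []|exact/real_integrableZ/iTA|exact: i2].
rewrite RintegralD; [|by []|exact/real_integrableZ/iAT|exact: real_integrable_cst].
have ETAab : \int[P]_w (T w *m A) a b = A a b.
  by have /matrixP/(_ a b) := ETA; rewrite mexpectE ET mul1mx.
have EATab : \int[P]_w (A *m T w) a b = A a b.
  by have /matrixP/(_ a b) := EAT; rewrite mexpectE ET mulmx1.
rewrite RintegralZl; [|by []|exact: iTA].
rewrite RintegralZl; [|by []|exact: iAT].
rewrite ETAab EATab Rintegral_cst //.
rewrite [X in fine X]probability_setT /= [in RHS]mxE; ring.
Qed.

End MatrixExpectation.

(** * The algorithm *)

Section DetCGD2VR.
Context {R : realType} {d n : nat}.
Variables (fi : 'I_n -> 'cV[R]_d -> R) (Li : 'I_n -> 'M[R]_d) (L : 'M[R]_d).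
Context {dX : measure_display} {X : measurableType dX} {dO : measure_display}
  {O : measurableType dO}.
Variables (S : probability X R) (sk : X -> 'M[R]_d) (P : probability O R).
Variables (c : nat -> O -> bool) (xi : nat -> 'I_n -> O -> X).
Variables (p : R) (D : 'M[R]_d) (x0 : 'cV[R]_d).
Hypotheses (d0 : (0 < d)%N) (n0 : (0 < n)%N).
Let f := fun x => n%:R^-1 * \sum_(i < n) fi i x.
Hypothesis C1fi : forall i, C1 (fi i).
Hypothesis spdLi : forall i, spd (Li i).
Hypothesis spdL : spd L.
Hypothesis lipLi : forall i, lipschitz_grad (Li i) (fi i).
Hypothesis lipL : lipschitz_grad L f.
Hypothesis msk : forall i j, measurable_fun setT (fun x => sk x i j).
Hypothesis psdsk : forall x, psd (sk x).
Hypothesis isk : forall i j, S.-integrable setT (fun x => (sk x i j)%:E).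
Hypothesis Esk : mexpect S sk = 1%:M.
Hypothesis isk2 :
  forall i j k l, S.-integrable setT (fun x => (sk x i j * sk x k l)%:E).
Hypothesis mc : forall k, measurable_fun setT (c k).
Hypothesis Pc : forall k, P [set w | c k w] = p%:E.
Hypothesis mxi : forall k i, measurable_fun setT (xi k i).
Hypothesis lawxi : forall k i (A : set X), measurable A ->
  P (xi k i @^-1` A) = S A.
Let F (j : nat * option 'I_n) : set (set O) :=
  match j.2 with
  | None => preimage_sigma (c j.1)
  | Some i => preimage_sigma (xi j.1 i)
  end.
Hypothesis indF : mutually_independent P F.
Hypothesis p01 : 0 < p <= 1.
Hypothesis spdD : spd D.

Let lam1 := lambda_max (D *m mexpect S (fun x => sk x *m invmx D *m sk x) *m D - D).
Let Rp := n%:R^-1 * \sum_(i < n) (lam1 * lambda_max (Li i)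
       * lambda_max (msqrt (invmx L) *m Li i *m msqrt (invmx L))).
Hypothesis step_size :
  loewner_ge (invmx D) (((1 - p) * Rp / (n%:R * p) + 1) *: L).

Let state k w := detCGD2VR fi D x0 (fun k => c k w) (fun k i => sk (xi k i w)) k.
Let x k w := (state k w).1.
Let g k w := (state k w).2.
Let e k w := g k w - D *m grad f (x k w).
Let T k i w := sk (xi k i w).
(** The factor 1 - c_k as a real variable: it is 0 when the full gradient refreshes the
    estimator. *)
Let q k w : R := (~~ c k w)%:R.

Let nR : (n%:R : R) != 0. Proof. by rewrite pnatr_eq0 -lt0n. Qed.

Let dfi i y : differentiable (fi i) y. Proof. by have [] := C1fi i. Qed.

Let df y : differentiable f y.
Proof. by apply: differentiable_mean => i; exact: dfi. Qed.

Let gradf y : grad f y = n%:R^-1 *: \sum_(i < n) grad (fi i) y.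
Proof. by apply: grad_mean => i; exact: dfi. Qed.

Let preimage_sigma_meas dY (Y : measurableType dY) (h : O -> Y) :
  measurable_fun setT h -> preimage_sigma h `<=` measurable.
Proof. by move=> mh _ [B mB <-]; rewrite -[_ @^-1` _]setTI; exact: mh. Qed.

Let preimage_sigmaI dY (Y : measurableType dY) (h : O -> Y) :
  setI_closed (preimage_sigma h).
Proof.
move=> _ _ [A mA <-] [B mB <-]; exists (A `&` B); last by rewrite preimage_setI.
exact: measurableI.
Qed.

Let Fm j : F j `<=` measurable.
Proof. by rewrite /F; case: j.2 => [i|]; exact: preimage_sigma_meas. Qed.

Let FT j : F j setT.
Proof.
by rewrite /F; case: j.2 => [i|]; exists setT; rewrite ?preimage_setT //; exact: measurableT.
Qed.

Let FI j : setI_closed (F j).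
Proof. by rewrite /F; case: j.2 => [i|]; exact: preimage_sigmaI. Qed.

(* Index [(j, None)] stands for the coin [c_j] and [(j, Some i)] for the sketch
   [T_i^j]; [past k] lists the randomness that determines [x^k] and [g^k]. *)
Let past k : seq (nat * option 'I_n) :=
  allpairs pair (iota 0 k) (enum {: option 'I_n}).
Let cyl J := cylinder F J.

Let mem_past k j : (j \in past k) = (j.1 < k)%N.
Proof.
case: j => m o; rewrite /past; apply/allpairsP/idP => [[[a b] /=]|mk].
  by rewrite mem_iota => -[/andP[_ ak] _ [-> _]].
by exists (m, o); rewrite mem_iota mem_enum.
Qed.

Let cylm J : cyl J `<=` measurable.
Proof. exact: cylinder_measurable. Qed.

Let cyl_sub J1 J2 : {subset J1 <= J2} -> cyl J1 `<=` cyl J2.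
Proof. exact: cylinder_sub. Qed.

Let adapted_gen J j (h : O -> R) : j \in J ->
  (forall B, measurable B -> F j (h @^-1` B)) -> adapted (cyl J) h.
Proof.
move=> jJ hF; apply: adaptedP => B mB; apply: sub_sigma_algebra.
exact: (sub_cylinder FT jJ (hF B mB)).
Qed.

(** * Measurability and moments of sketches and coins *)

Let aT k i a b J : (k, Some i) \in J -> adapted (cyl J) (fun w => T k i w a b).
Proof.
move=> kJ; apply: (adapted_gen kJ) => B mB.
exists ((fun y => sk y a b) @^-1` B) => //.
by rewrite /= -[X in measurable X]setTI; exact: msk.
Qed.

Let aq k J : (k, None) \in J -> adapted (cyl J) (q k).
Proof.
move=> kJ; apply: (adapted_gen kJ) => B mB.
by exists ((fun b : bool => (~~ b)%:R) @^-1` B).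
Qed.

Let iT k i a b : real_integrable P (fun w => T k i w a b) /\
  \int[P]_w T k i w a b = (a == b)%:R.
Proof.
have [h1 h2] := law_integral (mxi k i) (lawxi k i) (isk a b).
split=> //; rewrite h2.
have /matrixP/(_ a b) := Esk; by rewrite mexpectE mxE.
Qed.

Let iTT k i a b a' b' : real_integrable P (fun w => T k i w a b * T k i w a' b') /\
  \int[P]_w (T k i w a b * T k i w a' b') = \int[S]_y (sk y a b * sk y a' b').
Proof. exact: (law_integral (mxi k i) (lawxi k i) (isk2 a b a' b')). Qed.

Let sqT k i a b : sq_integrable P (fun w => T k i w a b).
Proof.
split; first exact: real_integrable_meas (iT k i a b).1.
by under eq_fun do rewrite expr2; exact: (iTT k i a b a b).1.
Qed.

Let aq_meas k : measurable_fun setT (q k).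
Proof. by apply: adapted_meas (aq (mem_head _ [::])); exact: cylm. Qed.

Let q01 k w : q k w ^+ 2 = q k w.
Proof. by rewrite /q; case: (c k w); rewrite /= ?expr0n ?expr1n. Qed.

Let iq k : real_integrable P (q k) /\ \int[P]_w q k w = 1 - p.
Proof.
have iq1 : real_integrable P (q k).
  apply: real_integrable_dom (real_integrable_cst P 1) => // w.
  by rewrite /q; case: (c k w); rewrite /= ?normr0 ?normr1.
split=> //; have mC : measurable [set w | c k w].
  rewrite (_ : [set w | c k w] = setT `&` c k @^-1` [set true]) ?setTI //.
  by rewrite -[X in measurable X]setTI; exact: mc.
have qE w : q k w = 1 + -1 * \1_[set w | c k w] w.
  have -> : \1_[set w | c k w] w = (c k w)%:R :> R.
    by rewrite indicE; congr (nat_of_bool _)%:R; apply/idP/idP; rewrite inE.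
  by rewrite /q; case: (c k w); rewrite /=; ring.
have iC : real_integrable P (\1_[set w | c k w] : O -> R).
  apply: real_integrable_dom (real_integrable_cst P 1) => // w.
  by rewrite indicE; case: (_ \in _); rewrite /= ?normr0 ?normr1.
under eq_fun do rewrite qE.
rewrite RintegralD; [|by []|exact: real_integrable_cst|exact: real_integrableZ].
rewrite RintegralZl; [|by []|exact: iC].
rewrite Rintegral_cst // [X in fine X]probability_setT /= /Rintegral.
rewrite integral_indic; [|exact: measurableT|exact: mC].
rewrite setIT (_ : fine _ = p); last exact: (congr1 fine (Pc k)).
by ring.
Qed.

(** Continuity of the gradient enters here: it makes the gradient at a random point measurable for
    the same information. *)
Let grad_adapted G i (Y : O -> 'cV[R]_d) : vadapted G Y ->
  vadapted G (fun w => grad (fi i) (Y w)).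
Proof.
move=> aY a; apply: (measurable_fun_continuous_comp
  (h := fun y => grad (fi i) y a ord0) aY) => y.
have [_ cg] := C1fi i.
apply: (@continuous_comp _ _ _ (grad (fi i)) (fun v : 'cV[R]_d => v a ord0) y (cg y)).
exact: coord_continuous.
Qed.

Let grad_bound i y z : qf 1%:M (grad (fi i) y - grad (fi i) z) <=
  lambda_max (Li i) * qf (Li i) (y - z).
Proof.
apply: (le_trans (lambda_max_inv _ (spdLi i))); apply: ler_wpM2l.
  exact: lambda_max_ge0 (spd_psd (spdLi i)).
exact: lipschitz_grad_qf.
Qed.

(** Comparison with the fixed point [x0]: the Lipschitz bound controls the gradient difference by
    the square-integrable [Y w - x0]. *)
Let grad_vsq G i (Y : O -> 'cV[R]_d) : G `<=` measurable -> vadapted G Y ->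
  vsq P Y -> vsq P (fun w => grad (fi i) (Y w)).
Proof.
move=> Gm aY sY.
have -> : (fun w => grad (fi i) (Y w)) =
    (fun w => (grad (fi i) (Y w) - grad (fi i) x0) + grad (fi i) x0).
  by apply/funext => w; rewrite subrK.
apply: vsqD; last exact: vsq_cst.
have aD : vadapted G (fun w => grad (fi i) (Y w) - grad (fi i) x0).
  by apply: vadaptedB; [exact: grad_adapted | exact: vadapted_cst].
move=> a; apply: (@sq_integrable_dom _ _ _ P (lambda_max (Li i)) _
  (fun w => qf (Li i) (Y w - x0))).
- exact: adapted_meas (aD a).
- move=> w; apply: le_trans (grad_bound i (Y w) x0).
  by rewrite qf1E (bigD1 a) //= lerDl sumr_ge0 // => j _; exact: sqr_ge0.
- by apply: real_integrable_qf; apply: vsqB => //; exact: vsq_cst.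
Qed.

(** * Error recursion *)

Let xS k w : x k.+1 w = x k w - g k w.
Proof. by rewrite /x /g /state /=; case: detCGD2VR. Qed.

Let U k i w := D *m (grad (fi i) (x k.+1 w) - grad (fi i) (x k w)).
Let M k i w : 'M[R]_d := T k i w - 1%:M.
Let V k i w := n%:R^-1 *: U k i w.
(** The error the next iterate would have if the coin came up 0; the factor 1/n is already inside
    [V]. *)
Let Z k w := e k w + \sum_(i <- enum 'I_n) M k i w *m V k i w.

Let gS k w : g k.+1 w = D *m grad f (x k.+1 w) + q k w *: Z k w.
Proof.
have -> : g k.+1 w = n%:R^-1 *: \sum_(i < n)
    (if c k w then D *m grad (fi i) (x k.+1 w) else
     g k w + T k i w *m U k i w).
  rewrite /U xS /g /x /state /=; case: detCGD2VR => /= y h; congr (_ *: _).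
  by apply: eq_bigr => i _; rewrite mulmxA.
rewrite /q; case: (c k w) => /=.
  by rewrite scale0r addr0 gradf -scalemxAr mulmx_sumr.
rewrite scale1r big_split /= scalerDr sumr_const card_ord -[g k w *+ n]scaler_nat.
rewrite scalerA mulVf // scale1r /Z /e.
(* The identity part of M = T - I subtracts the mean of the [U k i w], which is D applied to the
   increment of grad f. *)
have -> : \sum_(i <- enum 'I_n) M k i w *m V k i w =
    n%:R^-1 *: (\sum_(i < n) T k i w *m U k i w) -
    (D *m grad f (x k.+1 w) - D *m grad f (x k w)).
  rewrite big_enum /= -mulmxBr !gradf -scalerBr -sumrB -scalemxAr mulmx_sumr.
  rewrite -scalerBr -sumrB scaler_sumr; apply: eq_bigr => i _.
  by rewrite /M /V -scalemxAr mulmxBl mul1mx.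
by apply/colP => a; rewrite !mxE; ring.
Qed.

Let eS k w : e k.+1 w = q k w *: Z k w.
Proof. by rewrite /e gS addrC addKr. Qed.

(** Kept as a hypothesis of the lemmas on step k, because its own induction step needs them. *)
Let invariant k := [/\ vadapted (cyl (past k)) (x k), vadapted (cyl (past k)) (g k),
  vsq P (x k) & vsq P (g k)].

Let gradf_adapted G (Y : O -> 'cV[R]_d) : vadapted G Y ->
  vadapted G (fun w => grad f (Y w)).
Proof.
move=> aY; under eq_fun do rewrite gradf.
by apply: vadaptedZ; apply: vadapted_sum => i; exact: grad_adapted.
Qed.

Let gradf_vsq G (Y : O -> 'cV[R]_d) : G `<=` measurable -> vadapted G Y ->
  vsq P Y -> vsq P (fun w => grad f (Y w)).
Proof.
move=> Gm aY sY; under eq_fun do rewrite gradf.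
by apply: vsqZ; apply: vsq_sum => i; exact: grad_vsq Gm aY sY.
Qed.

Let vadapted_cmul G (A : 'M[R]_d) (Y : O -> 'cV[R]_d) : vadapted G Y ->
  vadapted G (fun w => A *m Y w).
Proof. by move=> aY; apply: vadapted_mulmx => // a b; exact: measurable_cst. Qed.

Let eprops k : invariant k -> vadapted (cyl (past k)) (e k) /\ vsq P (e k).
Proof.
move=> [ax ag sx sg]; split.
  by apply: vadaptedB => //; apply: vadapted_cmul; exact: gradf_adapted.
by apply: vsqB => //; apply: vsq_mulmx; apply: gradf_vsq ax sx; exact: cylm.
Qed.

Let xprops k : invariant k ->
  vadapted (cyl (past k)) (x k.+1) /\ vsq P (x k.+1).
Proof.
move=> [ax ag sx sg]; rewrite (_ : x k.+1 = fun w => x k w - g k w).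
  by split; [exact: vadaptedB | exact: vsqB].
by apply/funext => w; exact: xS.
Qed.

Let Vprops k i : invariant k ->
  vadapted (cyl (past k)) (V k i) /\ vsq P (V k i).
Proof.
move=> ik; have [ax ag sx sg] := ik; have [ax' sx'] := xprops ik; split.
  apply: vadaptedZ; apply: vadapted_cmul.
  by apply: vadaptedB; exact: grad_adapted.
apply: vsqZ; apply: vsq_mulmx; apply: vsqB.
  by apply: grad_vsq ax' sx'; exact: cylm.
by apply: grad_vsq ax sx; exact: cylm.
Qed.

Let fresh k : seq (nat * option 'I_n) := [seq (k, Some i) | i <- enum 'I_n].

(** The mean of (T - I) D^-1 (T - I); conjugated by D it is the matrix whose largest eigenvalue
    enters R'. *)
Let N := mexpect S (fun y => sk y *m invmx D *m sk y) - invmx D.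

Let W k i w := (M k i w)^T *m invmx D *m M k i w.

Let EW k i : (forall a b, real_integrable P (fun w => W k i w a b)) /\
  mexpect P (W k i) = N.
Proof.
have ET : mexpect P (T k i) = 1%:M.
  by apply/matrixP => a b; rewrite mexpectE (iT k i a b).2 mxE.
have sT w : Defs.symmetricmx (T k i w) by case: (psdsk (xi k i w)).
have [iW E] := mexpect_centered (invmx D) sT (fun a b => (iT k i a b).1) (sqT k i) ET.
split=> //; rewrite [LHS]E; congr (_ - _).
have iTDT (A : 'M[R]_d) a b l m :
    real_integrable S (fun y => sk y a l * A l m * sk y m b).
  under eq_fun do rewrite mulrAC mulrC; apply: real_integrableZ; exact: isk2.
apply/matrixP => a b; rewrite !mexpectE.
have := @law_integral _ _ _ _ _ P S (xi k i) (mxi k i) (lawxi k i)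
  (fun y => (sk y *m invmx D *m sk y) a b).
case=> // ; under eq_fun do rewrite mxE; apply: real_integrable_sum => m.
by under eq_fun do rewrite mxE mulr_suml; apply: real_integrable_sum => l.
Qed.

Let stepZ k : invariant k ->
  [/\ vsq P (Z k), vadapted (cyl (past k ++ fresh k)) (Z k) &
    \int[P]_w qf (invmx D) (Z k w) = \int[P]_w qf (invmx D) (e k w) +
      \sum_(i <- enum 'I_n) \int[P]_w qf N (V k i w)].
Proof.
move=> ik; have [ae se] := eprops ik.
have inj : injective (fun i : 'I_n => (k, Some i)) by move=> i j [].
have np i : (k, Some i) \notin past k by rewrite mem_past /= ltnn.
have aM i a b : adapted (cyl [:: (k, Some i)]) (fun w => M k i w a b).
  under eq_fun do rewrite !mxE; apply: measurable_funB => //.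
  by apply: aT; rewrite inE.
have sM i a b : sq_integrable P (fun w => M k i w a b).
  under eq_fun do rewrite !mxE.
  by apply: sq_integrableD => //; exact: sq_integrable_cst.
have M0 i a b : \int[P]_w M k i w a b = 0.
  under eq_fun do rewrite !mxE.
  rewrite RintegralD; [|by []|exact: (iT k i a b).1|exact: real_integrable_cst].
  rewrite (iT k i a b).2 Rintegral_cst // [X in fine X]probability_setT /= mulr1.
  by rewrite subrr.
have sDi : Defs.symmetricmx (invmx D) by case: (spd_invmx spdD).
have [sZ aZ EZ] := indep_sum Fm FT FI indF inj np (enum_uniq 'I_n) sDi ae
  (fun i => (Vprops i ik).1) se (fun i => (Vprops i ik).2) aM sM M0.
split=> //; rewrite EZ; congr (_ + _); apply: eq_bigr => i _.
by rewrite -(EW k i).2.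
Qed.

(** The coin of step k belongs neither to the past nor to the sketches of that step, and its
    indicator equals its square, so it contributes exactly 1 - p. *)
Let qZ k : invariant k ->
  [/\ vadapted (cyl (past k.+1)) (fun w => q k w *: Z k w),
    vsq P (fun w => q k w *: Z k w) &
    \int[P]_w qf (invmx D) (q k w *: Z k w) =
      (1 - p) * \int[P]_w qf (invmx D) (Z k w)].
Proof.
move=> ik; have [sZ aZ _] := stepZ ik.
have sub1 : {subset past k ++ fresh k <= past k.+1}.
  move=> j; rewrite mem_cat !mem_past => /orP[/ltnW //|/mapP[i _ ->] //=].
have aqZ : vadapted (cyl (past k.+1)) (fun w => q k w *: Z k w).
  move=> a; under eq_fun do rewrite mxE; apply: measurable_funM.
    by apply: aq; rewrite mem_past.
  by apply: adapted_sub (aZ a); exact: cyl_sub.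
split=> //.
  move=> a; apply: (@sq_integrable_dom _ _ _ P 1 _ (fun w => Z k w a ord0 ^+ 2)).
  - exact: adapted_meas (aqZ a).
  - move=> w; rewrite mxE exprMn q01 /q mul1r.
    by case: (c k w); rewrite /= ?mul1r ?mul0r ?sqr_ge0.
  - by have [] := sZ a.
under eq_fun do rewrite qfZ q01.
have ind : sigma_indep P (cyl [:: (k, None)]) (cyl (past k ++ fresh k)).
  move=> A B; apply: sigma_cylinder_indep => // j; rewrite inE => /eqP ->.
  by rewrite mem_cat mem_past /= ltnn; apply/negP => /mapP[].
have [_ ->] := indep_integrableM ind (aq (mem_head _ _)) (adapted_qf (invmx D) aZ)
  (iq k).1 (real_integrable_qf (invmx D) sZ).
by rewrite (iq k).2.
Qed.

Let inv k : invariant k.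
Proof.
elim: k => [|k ik].
  by split; [exact: vadapted_cst|exact: vadapted_cst|exact: vsq_cst|exact: vsq_cst].
have [ax sx] := xprops ik; have [aZ sZ _] := qZ ik.
have sub1 : cyl (past k) `<=` cyl (past k.+1).
  by apply: cyl_sub => j; rewrite !mem_past => /ltnW.
have ax' : vadapted (cyl (past k.+1)) (x k.+1) by apply: vadapted_sub ax.
have gE : g k.+1 = fun w => D *m grad f (x k.+1 w) + q k w *: Z k w.
  by apply/funext => w; exact: gS.
rewrite /invariant gE; split=> //.
  by apply: vadaptedD => //; apply: vadapted_cmul; exact: gradf_adapted.
apply: vsqD => //; apply: vsq_mulmx; apply: gradf_vsq ax' sx; exact: cylm.
Qed.

(** * Bounding the noise and summing up *)

Let symD : D^T = D. Proof. by case: spdD. Qed.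

Let uD : D \in unitmx. Proof. exact: spd_unitmx. Qed.

Let DND : D *m N *m D = D *m mexpect S (fun y => sk y *m invmx D *m sk y) *m D - D.
Proof. by rewrite /N mulmxBr mulmxBl mulmxV // mul1mx. Qed.

(** Semidefiniteness is not visible in a difference; it is read off the centred form, for one sketch
    that exists because n > 0. *)
Let psdN : psd N.
Proof.
have i0 : 'I_n := Ordinal n0.
have [iW EN] := EW 0 i0.
have psdW w : psd (W 0 i0 w).
  split; last by move=> v; rewrite -qf_conj; exact: psd_ge0 (spd_psd (spd_invmx spdD)).
  rewrite /Defs.symmetricmx /W !trmx_mul trmxK -mulmxA.
  by have [-> _] := spd_invmx spdD.
split=> [|v]; last first.
  by rewrite -EN qf_mexpect //; apply: Rintegral_ge0 => w _; exact: psd_ge0.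
rewrite -EN; apply/matrixP => a b; rewrite mxE !mexpectE.
by apply: eq_Rintegral => w _; have [sW _] := psdW w; rewrite -[in LHS]sW mxE.
Qed.

Let psdDND : psd (D *m N *m D).
Proof.
split=> [|v]; last by rewrite -{1}symD -qf_conj; exact: psd_ge0.
by rewrite /Defs.symmetricmx !trmx_mul symD psdN.1 mulmxA.
Qed.

Let lam1_ge0 : 0 <= lam1.
Proof. by rewrite /lam1 -DND; exact: lambda_max_ge0. Qed.

(** The three factors in R' are three changes of norm: D N D against the Euclidean norm, Euclidean
    against L_i through the Lipschitz gradient, and L_i against L. The two factors 1/n come from
    squaring [V]; one of them forms the average in R'. *)
Let noise_bound k i w : qf N (V k i w) <= n%:R^-1 * (n%:R^-1 * (lam1 * lambda_max (Li i)
  * lambda_max (msqrt (invmx L) *m Li i *m msqrt (invmx L)))) * qf L (g k w).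
Proof.
rewrite /V qfZ expr2 -!mulrA; do 2 (apply: ler_wpM2l; first by rewrite invr_ge0).
rewrite /U qf_conj symD.
have sDND := psdDND.1.
apply: (le_trans (lambda_max_ub _ sDND)); rewrite DND -/lam1.
apply: ler_wpM2l => //; apply: (le_trans (grad_bound _ _ _)).
apply: ler_wpM2l; first exact: lambda_max_ge0 (spd_psd (spdLi i)).
rewrite xS addrAC subrr add0r qfN.
by apply: lambda_max_relative => //; case: (spdLi i).
Qed.

Let v k := \int[P]_w qf (invmx D) (e k w).
Let l k := \int[P]_w qf L (g k w).

Let v0 : v 0 = 0.
Proof.
have e0 w : e 0 w = 0 by rewrite /e /g /x /state /= subrr.
by rewrite /v; under eq_fun do rewrite e0 qf0; rewrite Rintegral_cst // mul0r.
Qed.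

Let v_ge0 k : 0 <= v k.
Proof. by apply: Rintegral_ge0 => w _; exact: psd_ge0 (spd_psd (spd_invmx spdD)). Qed.

Let sqg k : vsq P (g k). Proof. by case: (inv k). Qed.
Let sqe k : vsq P (e k). Proof. by case: (eprops (inv k)). Qed.
Let sqgradf k : vsq P (fun w => grad f (x k w)).
Proof. by have [ax _ sx _] := inv k; apply: gradf_vsq ax sx; exact: cylm. Qed.

Let vS k : v k.+1 <= (1 - p) * (v k + n%:R^-1 * Rp * l k).
Proof.
have [_ _ EqZ] := qZ (inv k); have [_ _ EZ] := stepZ (inv k).
have p1 : 0 <= 1 - p by case/andP: p01 => _; rewrite subr_ge0.
have -> : v k.+1 = \int[P]_w qf (invmx D) (q k w *: Z k w).
  by apply: eq_Rintegral => w _; rewrite eS.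
rewrite EqZ EZ; apply: ler_wpM2l => //; rewrite lerD2l.
rewrite /Rp mulr_sumr mulr_sumr mulr_suml big_enum /=.
apply: ler_sum => i _; rewrite -RintegralZl //; last exact: real_integrable_qf.
apply: le_Rintegral => //.
- by apply: real_integrable_qf; have [] := Vprops i (inv k).
- by apply: real_integrableZ; exact: real_integrable_qf.
Qed.

Let path_sum K w : f (x K w) <= f x0 + \sum_(k < K)
  (- 2^-1 * qf D (grad f (x k w)) + 2^-1 * qf (invmx D) (e k w)
   + 2^-1 * (qf L (g k w) - qf (invmx D) (g k w))).
Proof.
elim: K => [|K IH]; first by rewrite big_ord0 addr0.
rewrite xS big_ord_recr /= addrA.
apply: (le_trans (preconditioned_descent _ _ spdL spdD df lipL)).
by rewrite lerD2r.
Qed.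

(** The excess over L in the step-size condition becomes a negative multiple of |y|_L^2, which will
    pay for the accumulated error. *)
Let step_bound y : qf L y - qf (invmx D) y <=
  - ((1 - p) * Rp / (n%:R * p)) * qf L y.
Proof.
have := psd_ge0 y step_size; rewrite qfBm qfZm.
by move: (_ / _) (qf _ _) (qf _ _) => r a b; lra.
Qed.

Lemma sum_gradient_bound (fstar : R) K : (forall y, fstar <= f y) ->
  \sum_(k < K) \int[P]_w qf D (grad f (x k w)) <= 2 * (f x0 - fstar).
Proof.
move=> lef; have [p0 _] := andP p01.
set r := (1 - p) * Rp / (n%:R * p).
have rE : r = (1 - p) * (n%:R^-1 * Rp) / p.
  by rewrite /r invfM mulrACA -!mulrA [n%:R^-1 * _]mulrCA.
(* Linear arithmetic isolated on plain reals, with whole sums as its arguments. *)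
have half (a0 a1 b c' l' : R) : fstar <= a0 + (- 2^-1 * a1 + 2^-1 * b + 2^-1 * c') ->
    c' <= - r * l' -> a1 <= 2 * (a0 - fstar) + (b + - r * l') by move=> *; lra.
have pw w : \sum_(k < K) qf D (grad f (x k w)) <= 2 * (f x0 - fstar) +
    (\sum_(k < K) qf (invmx D) (e k w) + - r * \sum_(k < K) qf L (g k w)).
  apply: (half _ _ _ (\sum_(k < K) (qf L (g k w) - qf (invmx D) (g k w)))).
    by have := le_trans (lef _) (path_sum K w); rewrite !big_split /= -!mulr_sumr -big_split.
  by rewrite mulr_sumr; apply: ler_sum => k _; exact: step_bound.
have iD k : real_integrable P (fun w => qf D (grad f (x k w))).
  exact: real_integrable_qf.
have ie k : real_integrable P (fun w => qf (invmx D) (e k w)).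
  exact: real_integrable_qf.
have ig k : real_integrable P (fun w => qf L (g k w)) by exact: real_integrable_qf.
have iSe : real_integrable P (fun w => \sum_(k < K) qf (invmx D) (e k w)).
  by apply: real_integrable_sum => k; exact: ie.
have iSg : real_integrable P (fun w => \sum_(k < K) qf L (g k w)).
  by apply: real_integrable_sum => k; exact: ig.
have iR : real_integrable P (fun w => \sum_(k < K) qf (invmx D) (e k w) +
    - r * \sum_(k < K) qf L (g k w)).
  by apply: real_integrableD => //; exact: real_integrableZ.
rewrite -Rintegral_sum //.
apply: (@le_trans _ _ (\int[P]_w (2 * (f x0 - fstar) +
    (\sum_(k < K) qf (invmx D) (e k w) + - r * \sum_(k < K) qf L (g k w))))).
  apply: le_Rintegral => //; first exact: real_integrable_sum.
  by apply: real_integrableD => //; exact: real_integrable_cst.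
rewrite RintegralD; [|by []|exact: real_integrable_cst|exact: iR].
rewrite Rintegral_cst // [X in fine X]probability_setT /= mulr1.
rewrite RintegralD; [|by []|exact: iSe|exact: real_integrableZ].
rewrite RintegralZl; [|by []|exact: iSg].
rewrite Rintegral_sum // Rintegral_sum //.
(* What remains is that the summed error is at most r times the summed |g^k|_L^2; the spare term v K
   / p is nonnegative and is dropped. *)
rewrite gerDl mulNr subr_le0 rE.
apply: le_trans (potential_sum K p0 v0 vS).
by rewrite lerDl divr_ge0 // ltW.
Qed.

Lemma gradient_norm_integrable k :
  P.-integrable setT (fun w => (qf D (grad f (x k w)))%:E).
Proof. exact: real_integrable_qf. Qed.

End DetCGD2VR.

Unset Implicit Arguments.

Theorem theorem3 (R : realType) (d n : nat)
    (fi : 'I_n -> 'cV[R]_d -> R) (fstar : R)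
    (Li : 'I_n -> 'M[R]_d) (L : 'M[R]_d)
    (* sketch distribution S: law of sk under the probability S on X *)
    (dX : measure_display) (X : measurableType dX) (S : probability X R)
    (sk : X -> 'M[R]_d)
    (* underlying probability space carrying all the randomness *)
    (dO : measure_display) (O : measurableType dO) (P : probability O R)
    (c : nat -> O -> bool) (xi : nat -> 'I_n -> O -> X)
    (p : R) (D : 'M[R]_d) (x0 : 'cV[R]_d) (K : nat) :
  (0 < d)%N -> (0 < n)%N ->
  let f := fun x => n%:R^-1 * \sum_(i < n) fi i x in
  (forall i, C1 (fi i)) ->
  (forall x, fstar <= f x) ->
  (forall i, spd (Li i)) -> spd L ->
  (forall i, lipschitz_grad (Li i) (fi i)) -> lipschitz_grad L f ->
  (* the sketch distribution: symmetric psd, E[T] = I, finite second moments *)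
  (forall i j, measurable_fun setT (fun x => sk x i j)) ->
  (forall x, psd (sk x)) ->
  (forall i j, S.-integrable setT (fun x => (sk x i j)%:E)) ->
  mexpect S sk = 1%:M ->
  (forall i j k l, S.-integrable setT (fun x => (sk x i j * sk x k l)%:E)) ->
  (* c_k ~ Bernoulli(p), T_i^k = sk (xi k i) with xi k i ~ S, all mutually independent *)
  (forall k, measurable_fun setT (c k)) ->
  (forall k, P [set w | c k w] = p%:E) ->
  (forall k i, measurable_fun setT (xi k i)) ->
  (forall k i (A : set X), measurable A -> P (xi k i @^-1` A) = S A) ->
  mutually_independent P
    (fun j : nat * option 'I_n =>
       match j.2 with
       | None => preimage_sigma (c j.1)
       | Some i => preimage_sigma (xi j.1 i)
       end) ->
  0 < p <= 1 -> spd D ->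
  let Rp := n%:R^-1 * \sum_(i < n)
      (lambda_max (D *m mexpect S (fun x => sk x *m invmx D *m sk x) *m D - D)
       * lambda_max (Li i)
       * lambda_max (msqrt (invmx L) *m Li i *m msqrt (invmx L))) in
  loewner_ge (invmx D) (((1 - p) * Rp / (n%:R * p) + 1) *: L) ->
  (1 <= K)%N ->
  let detD := (\det D) `^ (d%:R^-1) in
  ((K%:R^-1)%:E *
     \sum_(k < K) \int[P]_w
        (qf (detD^-1 *: D)
            (grad f (detCGD2VR fi D x0 (fun k => c k w)
                       (fun k i => sk (xi k i w)) k).1))%:E
   <= (2 * (f x0 - fstar) / (detD * K%:R))%:E)%E.
Proof.
move=> d0 n0 f C1fi lef spdLi spdL lipLi lipL msk psdsk isk Esk isk2 mc Pc mxi
  lawxi indF p01 spdD Rp step K1.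
pose detD := \det D `^ d%:R^-1; cbv zeta; rewrite -/detD.
have uD : \det D != 0 by have := spd_unitmx spdD; rewrite unitmxE unitfE.
(* A real power of a nonzero base is an exponential, so invertibility of [D] gives positivity. *)
have detD0 : 0 < detD by rewrite /detD /powR (negPf uD) expR_gt0.
have K0 : 0 < (K%:R : R) by rewrite ltr0n.
set y := fun k w => grad f (detCGD2VR fi D x0 (fun k => c k w)
  (fun k i => sk (xi k i w)) k).1.
have iy k : real_integrable P (fun w => qf D (y k w)).
  exact: (gradient_norm_integrable x0 d0 n0 C1fi spdLi lipLi msk psdsk isk Esk isk2
    mc Pc mxi lawxi indF spdD).
have bound := sum_gradient_bound x0 d0 n0 C1fi spdLi spdL lipLi lipL msk psdsk isk
  Esk isk2 mc Pc mxi lawxi indF p01 spdD step K lef.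
(* Integrability identifies the extended-real integral of the statement with a finite expectation,
   and the determinant factor comes out. *)
have intE k : (\int[P]_w (qf (detD^-1 *: D) (y k w))%:E =
    (detD^-1 * \int[P]_w qf D (y k w))%:E)%E.
  rewrite -RintegralZl; [|by []|exact: iy].
  rewrite /Rintegral fineK.
    by apply: eq_integral => w _; rewrite qfZm.
  by apply: integrable_fin_num => //; exact: (real_integrableZ detD^-1 (iy k)).
rewrite (eq_bigr _ (fun (k : 'I_K) _ => intE k)) sumEFin -EFinM lee_fin.
rewrite -mulr_sumr mulrA -invfM [leRHS]mulrC [K%:R * _]mulrC.
by apply: ler_wpM2l => //; rewrite invr_ge0 mulr_ge0 // ltW.
Qed.
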